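(* Let $K$ be a nonnegative matrix with QBD block structure satisfying the irreducibility assumptions of the context, and let $\overline{K}$, $K_+$, $C_0$, $A_{-1},A_0,A_1$ and $\Gamma^{(1d)}_+=\{\theta\in\mathbb{R};\ \gamma^{(A_* )}(\theta)\le 1\}$ be as in the context. (a) If $\Gamma^{(1d)}_+\neq\emptyset$, then $N\equiv (I-K_+)^{-1}$ is finite, and therefore $G_-\equiv N_{11}A_{-1}$ is well defined and finite, where $N_{11}$ is the $(1,1)$ block (of size $m\times m$) of $N$. (b) $c_p(\overline{K})\ge 1$ holds if and only if $\Gamma^{(1d)}_+\neq\emptyset$ and $$\gamma_{\mathrm{pf}}(C_0+A_1G_-)\le 1 .$$ If equality holds in the last inequality, then $c_p(\overline{K})=1$.
   Context: Inequalities between vectors are entrywise. For a nonnegative square matrix $T$ (finite or infinite dimensional), $c_p(T)=\sup\{u\ge 0;\ \sum_{n=0}^\infty u^nT^n<\infty\}$ is its convergence parameter, and $(I-T)^{-1}$ denotes $\sum_{n=0}^\infty T^n$ (possibly with infinite entries). For finite dimensional $T$, $\gamma_{\mathrm{pf}}(T)$ is the Perron-Frobenius eigenvalue. QBD block structure: let $m_0,m$ be positive integers, $A_{-1},A_0,A_1$ nonnegative $m\times m$ matrices, $B_0$ a nonnegative $m_0\times m_0$ matrix, $B_1$ a nonnegative $m_0\times m$ matrix and $B_{-1}$ a nonnegative $m\times m_0$ matrix, and $$K=\begin{pmatrix} B_0&B_1&0&0&\cdots\\ B_{-1}&A_0&A_1&0&\cdots\\ 0&A_{-1}&A_0&A_1&\cdots\\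 &\ddots&\ddots&\ddots&\ddots\end{pmatrix}.$$ Put $C_0=B_{-1}(I-B_0)^{-1}B_1+A_0$ and $$\overline{K}=\begin{pmatrix} C_0&A_1&0&0&\cdots\\ A_{-1}&A_0&A_1&0&\cdots\\ 0&A_{-1}&A_0&A_1&\cdots\\ &\ddots&\ddots&\ddots&\ddots\end{pmatrix},\qquad K_+=\begin{pmatrix} A_0&A_1&0&\cdots\\ A_{-1}&A_0&A_1&\cdots\\ 0&A_{-1}&A_0&\ddots\\ &\ddots&\ddots&\ddots\end{pmatrix}.$$ Blocks of $K_+$ (and of $(I-K_+)^{-1}$) are indexed from $1$. Let $A_*(\theta)=e^{-\theta}A_{-1}+A_0+e^{\theta}A_1$ and $\gamma^{(A_* )}(\theta)=\gamma_{\mathrm{pf}}(A_*(\theta))$, $\theta\in\mathbb{R}$. Standing assumptions: $K$ is irreducible (for each entry $(i,j)$ there is $n\ge1$ with $(K^n)_{ij}>0$), and $A_*(0)$ is irreducible. *)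

(* Defs.v *)
From HB Require Import structures.
From mathcomp Require Import all_boot all_order all_algebra complex.
From mathcomp Require Import all_classical all_reals all_analysis.

Set Implicit Arguments.
Unset Strict Implicit.
Unset Printing Implicit Defensive.

Import Order.TTheory GRing.Theory Num.Theory.
Local Open Scope classical_set_scope.
Local Open Scope ring_scope.

(** A matrix is a function into [\bar R], because [(I - T)^-1], and hence the
    corner block [C_0], may have infinite entries. All matrices are meant to be
    nonnegative: sums are then unconditional, and MathComp-Analysis'
    convention [0 * +oo = 0] is the usual one. *)

Definition emx (R : realType) (I J : Type) := I -> J -> \bar R.

Definition of_mx (R : realType) (m n : nat) (A : 'M[R]_(m, n)) :
    emx R 'I_m 'I_n :=
  fun i j => (A i j)%:E.

Definition nonneg_mx (R : realType) (m n : nat) (A : 'M[R]_(m, n)) : Prop :=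
  forall i j, 0 <= A i j.

Section ExtendedMatrices.
Variable R : realType.
Local Open Scope ereal_scope.

Definition addM (I J : Type) (S T : emx R I J) : emx R I J :=
  fun i j => S i j + T i j.

Definition mulM (I J L : choiceType) (S : emx R I J) (T : emx R J L) :
    emx R I L :=
  fun i l => \esum_(j in [set: J]) (S i j * T j l).

Definition idM (I : choiceType) : emx R I I :=
  fun i j => if i == j then 1 else 0.

Definition powM (I : choiceType) (T : emx R I I) (n : nat) : emx R I I :=
  iter n (mulM T) (@idM I).

(** [(I - T)^-1], understood as the sum of the powers of [T]. *)
Definition neumann (I : choiceType) (T : emx R I I) : emx R I I :=
  fun i j => \sum_(0 <= n <oo) powM T n i j.

Definition finiteM (I J : Type) (T : emx R I J) : Prop :=
  forall i j, T i j \is a fin_num.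

Definition irreducibleM (I : choiceType) (T : emx R I I) : Prop :=
  forall i j, exists2 n, (0 < n)%N & 0 < powM T n i j.

Definition conv_param (I : choiceType) (T : emx R I I) : \bar R :=
  ereal_sup [set u%:E | u in [set u : R | (0 <= u)%R /\
    forall i j, \sum_(0 <= n <oo) ((u ^+ n)%:E * powM T n i j) < +oo]].

End ExtendedMatrices.

(** A real eigenvalue dominating the moduli of all complex eigenvalues. For a
    nonnegative matrix of positive size there is exactly one, by the
    Perron-Frobenius theorem, so that the default value of [xget] below is
    irrelevant. *)
Definition is_pf_eigenvalue (R : realType) (m : nat) (T : 'M[R]_m) (r : R) :
    Prop :=
  eigenvalue T r /\
  forall z : R[i], eigenvalue (map_mx (real_complex R) T) z ->
    `|z| <= real_complex R r.

Definition gamma_pf (R : realType) (m : nat) (T : 'M[R]_m) : R :=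
  xget 0 [set r | is_pf_eigenvalue T r].

(** Extension to matrices with infinite entries, where the value is [+oo]. *)
Definition egamma_pf (R : realType) (m : nat) (T : emx R 'I_m 'I_m) : \bar R :=
  if `[< finiteM T >] then (gamma_pf (\matrix_(i, j) fine (T i j)))%:E
  else +oo%E.

Section QBD.
Variables (R : realType) (m0 m : nat).
Variables (Am1 A0 A1 : 'M[R]_m).
Variables (B0 : 'M[R]_m0) (B1 : 'M[R]_(m0, m)) (Bm1 : 'M[R]_(m, m0)).

(** [(n, i)] is phase [i] of level [n + 1]. The first diagonal block is [C],
    the other blocks are those of a block Toeplitz tridiagonal matrix. *)
Definition qbd_levels (C : emx R 'I_m 'I_m) :
    emx R (nat * 'I_m)%type (nat * 'I_m)%type :=
  fun x y =>
    let: (k, i) := x in let: (l, j) := y in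
    if (k == 0)%N && (l == 0)%N then C i j
    else if l == k then (A0 i j)%:E
    else if l == k.+1 then (A1 i j)%:E
    else if k == l.+1 then (Am1 i j)%:E
    else 0%E.

(** [inl i] is phase [i] of level [0]. *)
Definition qbd_K :
    emx R ('I_m0 + nat * 'I_m)%type ('I_m0 + nat * 'I_m)%type :=
  fun x y =>
    match x, y with
    | inl i, inl j => (B0 i j)%:E
    | inl i, inr (l, j) => if l == 0%N then (B1 i j)%:E else 0%E
    | inr (k, i), inl j => if k == 0%N then (Bm1 i j)%:E else 0%E
    | inr x', inr y' => qbd_levels (of_mx A0) x' y'
    end.

Definition qbd_C0 : emx R 'I_m 'I_m :=
  addM (mulM (mulM (of_mx Bm1) (neumann (of_mx B0))) (of_mx B1)) (of_mx A0).

Definition qbd_Kbar := qbd_levels qbd_C0.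

Definition qbd_Kplus := qbd_levels (of_mx A0).

Definition A_star (theta : R) : 'M[R]_m :=
  expR (- theta) *: Am1 + A0 + expR theta *: A1.

Definition Gamma_plus_1d : set R :=
  [set theta | gamma_pf (A_star theta) <= 1].

Definition qbd_N := neumann qbd_Kplus.

Definition qbd_N11 : emx R 'I_m 'I_m := fun i j => qbd_N (0%N, i) (0%N, j).

Definition G_minus : emx R 'I_m 'I_m := mulM qbd_N11 (of_mx Am1).

End QBD.

(* Main.v *)
(** A function [x] on the levels that satisfies [Kbar x <= t x] with [t <= 1] is
    superharmonic above its lowest level; minimality of [G_-] then gives
    [G_- x_1 <= x_2], hence [(C_0 + A_1 G_-) x_1 <= t x_1] and
    [gamma_pf (C_0 + A_1 G_-) <= t]. Such an [x] exists for [t = 1] when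
    [c_p(Kbar) >= 1], and for [t = 1 / u] when the resolvent converges at some
    [u > 1]. Conversely, if [D = C_0 + A_1 G_-] satisfies [D h <= t h], then
    [x_1 = h, x_(k+1) = G_-^k h] satisfies [Kbar x <= t x].
    Moreover [N] is finite as soon as [K_+] has a positive superharmonic function
    that is strictly superharmonic where level [0] can be entered. For theta in
    Gamma the function [e^(theta k) h], with [h] the Perron-Frobenius vector of
    [A_*(theta)], is one. In the other direction, an eigenvector [G_- h = g h]
    with [g > 0] gives [A_*(ln g) h <= h], so that [ln g] is in Gamma. *)

Require Import Defs.
From HB Require Import structures.
From mathcomp Require Import all_boot all_order all_algebra complex.
From mathcomp Require Import finmap lra.
From mathcomp Require Import all_classical all_reals all_analysis.

Set Implicit Arguments.
Unset Strict Implicit.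
Unset Printing Implicit Defensive.

Import Order.TTheory GRing.Theory Num.Theory.
Import numFieldTopology.Exports numFieldNormedType.Exports.
Local Open Scope classical_set_scope.
Local Open Scope ring_scope.

(** * Nonnegative extended matrices *)

Definition ge0M (R : realType) (I J : Type) (T : emx R I J) : Prop :=
  forall i j, (0 <= T i j)%E.

Section NonnegativeMatrices.
Variable R : realType.
Local Open Scope ereal_scope.
Implicit Types I J K L : choiceType.

(** The factor may be [+oo]. Finite subsums give one inequality. For a finite positive factor the
    other one is the same inequality for the inverse factor; for [+oo] a single nonzero term makes
    the sum infinite. *)
Lemma esumZl I (a : I -> \bar R) (c : \bar R) : 0 <= c -> (forall i, 0 <= a i) ->
  \esum_(i in [set: I]) (c * a i) = c * \esum_(i in [set: I]) a i.
Proof.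
have ge (d : \bar R) (b : I -> \bar R) : 0 <= d -> (forall i, 0 <= b i) ->
    \esum_(i in [set: I]) (d * b i) <= d * \esum_(i in [set: I]) b i.
  move=> d0 b0; apply: ge_ereal_sup => _ [X [finX _]] <-.
  rewrite -ge0_mule_fsumr//; apply: lee_wpmul2l => //.
  by apply: ereal_sup_ubound; exists X.
move=> c0 a0; apply/eqP; rewrite eq_le ge//=.
case: c c0 => [c||]// c0.
- rewrite lee_fin le_eqVlt in c0; case/orP: c0 => [/eqP<-|c0].
    by rewrite mul0e esum_ge0// => i _; rewrite mul0e.
  rewrite -lee_pdivlMl//.
  have /le_trans-> // : \esum_(i in [set: I]) a i <=
      \esum_(i in [set: I]) ((c^-1)%:E * (c%:E * a i)).
    apply: le_esum => i _; rewrite muleA -EFinM mulVf ?mul1e// gt_eqF//.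
  by apply: ge; [rewrite lee_fin invr_ge0 ltW|move=> i; rewrite mule_ge0// lee_fin ltW].
- have [a00|/existsNP[i ai]] := pselect (forall i, a i = 0).
    by rewrite !esum1 ?mule0// => i _; rewrite a00 mule0.
  have {}ai : 0 < a i by rewrite lt_def a0 andbT; apply/eqP.
  suff -> : \esum_(i in [set: I]) (+oo * a i) = +oo by rewrite leey.
  apply/eqP; rewrite -leye_eq.
  apply: esum_ge; exists [set i]; first by split.
  by rewrite fsbig_set1 gt0_mulye.
Qed.

Lemma esumZr I (a : I -> \bar R) (c : \bar R) : 0 <= c -> (forall i, 0 <= a i) ->
  \esum_(i in [set: I]) (a i * c) = (\esum_(i in [set: I]) a i) * c.
Proof.
move=> c0 a0; rewrite muleC -esumZl//.
by apply: eq_esum => i _; rewrite muleC.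
Qed.

Lemma le_term_esum I (a : I -> \bar R) (i : I) : (forall i, 0 <= a i) ->
  a i <= \esum_(i in [set: I]) a i.
Proof.
by move=> a0; apply: esum_ge; exists [set i]; [by split|rewrite fsbig_set1].
Qed.

Lemma esum_swap I J (a : I -> J -> \bar R) : (forall i j, 0 <= a i j) ->
  \esum_(i in [set: I]) \esum_(j in [set: J]) a i j =
  \esum_(j in [set: J]) \esum_(i in [set: I]) a i j.
Proof.
move=> a0; rewrite !esum_esum//.
have bij : set_bij ([set: J] `*`` (fun=> [set: I])) ([set: I] `*`` (fun=> [set: J]))
    (fun x => (x.2, x.1)).
  by split=> // [x y _ _|[i j] _]; [case: x y => [? ?] [? ?] [-> ->]|exists (j, i)].
by rewrite (@reindex_esum _ _ _ _ _ _ _ bij).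
Qed.

Lemma esum_pairE I J (a : I * J -> \bar R) : (forall x, 0 <= a x) ->
  \esum_(x in [set: I * J]) a x = \esum_(i in [set: I]) \esum_(j in [set: J]) a (i, j).
Proof.
move=> a0; rewrite esum_esum//.
have bij : set_bij ([set: I] `*`` (fun=> [set: J])) [set: I * J] id.
  by split=> // x _; exists x.
by rewrite (@reindex_esum _ _ _ _ _ _ _ bij); apply: eq_esum => -[].
Qed.

Lemma esum_if1 I (a : \bar R) (i0 : I) : 0 <= a ->
  \esum_(i in [set: I]) (if i == i0 then a else 0) = a.
Proof.
move=> a0; rewrite -[RHS](@esum_set1 R I i0 (fun=> a))// [RHS]esum_mkcond.
by apply: eq_esum => i _; rewrite in_set1.
Qed.

Lemma esum_gt0P I (a : I -> \bar R) : (forall i, 0 <= a i) ->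
  0 < \esum_(i in [set: I]) a i -> exists i, 0 < a i.
Proof.
move=> a0; apply: contraPP => /forallNP na.
rewrite esum1 ?ltxx// => i _; apply/eqP; rewrite eq_le a0 andbT leNgt.
exact/negP.
Qed.

Lemma esum_ordE (n : nat) (b : 'I_n -> \bar R) :
  (forall i, 0 <= b i) -> \esum_(i in [set: 'I_n]) b i = \sum_(i < n) b i.
Proof.
move=> b0; have finI : finite_set [set: 'I_n] by exact: finite_finset.
rewrite esum_fset// fsbig_finite//=; apply: perm_big; apply: uniq_perm.
- exact: fset_uniq.
- exact: index_enum_uniq.
- by move=> i; rewrite in_fset_set// mem_index_enum mem_set.
Qed.

Lemma mulM_ge0 I J L (S : emx R I J) (T : emx R J L) :
  ge0M S -> ge0M T -> ge0M (mulM S T).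
Proof. by move=> S0 T0 i l; apply: esum_ge0 => j _; exact: mule_ge0. Qed.

Lemma addM_ge0 (I J : Type) (S T : emx R I J) :
  ge0M S -> ge0M T -> ge0M (addM S T).
Proof. by move=> S0 T0 i j; exact: adde_ge0. Qed.

Lemma idM_ge0 I : ge0M (@idM R I).
Proof. by move=> i j; rewrite /idM; case: ifP. Qed.

Lemma powM_ge0 I (T : emx R I I) n : ge0M T -> ge0M (powM T n).
Proof.
by move=> T0; elim: n => [|n IHn]; [exact: idM_ge0|exact: mulM_ge0].
Qed.

Lemma neumann_ge0 I (T : emx R I I) : ge0M T -> ge0M (neumann T).
Proof. by move=> T0 i j; apply: nneseries_ge0 => n _ _; exact: powM_ge0. Qed.

Hint Resolve mulM_ge0 addM_ge0 idM_ge0 powM_ge0 neumann_ge0 : core.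

Lemma neumann_esum I (T : emx R I I) i j : ge0M T ->
  neumann T i j = \esum_(n in [set: nat]) powM T n i j.
Proof. by move=> T0; rewrite /neumann nneseries_esumT// => n; exact: powM_ge0. Qed.

Lemma le_mulM I J L (S S' : emx R I J) (T T' : emx R J L) i l :
  ge0M S -> ge0M T -> (forall j, S i j <= S' i j) -> (forall j, T j l <= T' j l) ->
  mulM S T i l <= mulM S' T' i l.
Proof. by move=> S0 T0 SS' TT'; apply: le_esum => j _; exact: lee_pmul. Qed.

Lemma le_term_mulM I J L (S : emx R I J) (T : emx R J L) i j l :
  ge0M S -> ge0M T -> S i j * T j l <= mulM S T i l.
Proof.
move=> S0 T0; rewrite /mulM; apply: (@le_term_esum J (fun j => S i j * T j l)) => k.
exact: mule_ge0.
Qed.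

Lemma mulM_gt0 I J L (S : emx R I J) (T : emx R J L) i j l :
  ge0M S -> ge0M T -> 0 < S i j -> 0 < T j l -> 0 < mulM S T i l.
Proof.
by move=> S0 T0 Sij Tjl; apply: lt_le_trans (le_term_mulM i j l S0 T0); exact: mule_gt0.
Qed.

Lemma mulM_gt0P I J L (S : emx R I J) (T : emx R J L) i l :
  ge0M S -> ge0M T -> 0 < mulM S T i l -> exists2 j, 0 < S i j & 0 < T j l.
Proof.
move=> S0 T0 /esum_gt0P[j|j]; first exact: mule_ge0.
move=> ST; exists j; rewrite lt_def ?S0 ?T0 andbT; apply: contraTneq ST => ->.
  by rewrite mul0e ltxx.
by rewrite mule0 ltxx.
Qed.

Lemma mulMA I J K L (S : emx R I J) (T : emx R J K) (U : emx R K L) :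
  ge0M S -> ge0M T -> ge0M U -> mulM (mulM S T) U = mulM S (mulM T U).
Proof.
move=> S0 T0 U0; apply/funext => i; apply/funext => l; rewrite /mulM.
transitivity (\esum_(k in [set: K]) \esum_(j in [set: J]) (S i j * T j k * U k l)).
  by apply: eq_esum => k _; rewrite esumZr// => j; exact: mule_ge0.
rewrite esum_swap; last by move=> k j; rewrite !mule_ge0.
apply: eq_esum => j _; rewrite -esumZl//; last by move=> k; exact: mule_ge0.
by apply: eq_esum => k _; rewrite muleA.
Qed.

Lemma mulMDl I J L (S T : emx R I J) (U : emx R J L) :
  ge0M S -> ge0M T -> ge0M U -> mulM (addM S T) U = addM (mulM S U) (mulM T U).
Proof.
move=> S0 T0 U0; apply/funext => i; apply/funext => l; rewrite /mulM /addM.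
rewrite -esumD; [|by move=> j _; exact: mule_ge0..].
by apply: eq_esum => j _; rewrite ge0_muleDl.
Qed.

Lemma mul1M I L (T : emx R I L) : ge0M T -> mulM (@idM R I) T = T.
Proof.
move=> T0; apply/funext => i; apply/funext => l.
rewrite /mulM /idM -[RHS](@esum_if1 I _ i)//; apply: eq_esum => j _.
by rewrite (eq_sym i); case: eqVneq => [->|_]; rewrite ?mul1e ?mul0e.
Qed.

Lemma powMS I (T : emx R I I) n : powM T n.+1 = mulM T (powM T n).
Proof. by []. Qed.

Lemma powM_add I (T : emx R I I) m n : ge0M T ->
  powM T (m + n) = mulM (powM T m) (powM T n).
Proof.
move=> T0; elim: m => [|m IHm]; first by rewrite mul1M//; exact: powM_ge0.
by rewrite addSn !powMS IHm mulMA//; exact: powM_ge0.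
Qed.

Lemma le_powM_neumann I (T : emx R I I) n i j : ge0M T ->
  powM T n i j <= neumann T i j.
Proof.
move=> T0; rewrite neumann_esum//.
by apply: (@le_term_esum nat (fun n => powM T n i j)) => k; exact: powM_ge0.
Qed.

Lemma neumann_gt0P I (T : emx R I I) i j : ge0M T ->
  0 < neumann T i j -> exists n, 0 < powM T n i j.
Proof.
by move=> T0; rewrite neumann_esum// => /esum_gt0P; apply=> n; exact: powM_ge0.
Qed.

Lemma neumann_mulE I L (T : emx R I I) (s : emx R I L) i l : ge0M T -> ge0M s ->
  mulM (neumann T) s i l = \esum_(n in [set: nat]) mulM (powM T n) s i l.
Proof.
move=> T0 s0; rewrite /mulM [RHS]esum_swap => [|n j]; last first.
  by rewrite mule_ge0//; exact: powM_ge0.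
apply: eq_esum => j _; rewrite neumann_esum// esumZr// => n; exact: powM_ge0.
Qed.

Lemma esum_nat_recl (f : nat -> \bar R) : (forall n, 0 <= f n) ->
  \esum_(n in [set: nat]) f n = f 0%N + \esum_(n in [set: nat]) f n.+1.
Proof.
move=> f0; rewrite -!nneseries_esumT// nneseries_recl//; congr (_ + _).
by rewrite -nneseries_addn//; under eq_eseriesr do rewrite addn1.
Qed.

Lemma neumannE I (T : emx R I I) : ge0M T ->
  neumann T = addM (@idM R I) (mulM T (neumann T)).
Proof.
move=> T0; apply/funext => i; apply/funext => j.
rewrite /addM neumann_esum// esum_nat_recl; last by move=> n; exact: powM_ge0.
congr (_ + _); rewrite /mulM.
transitivity (\esum_(k in [set: I]) \esum_(n in [set: nat]) (T i k * powM T n k j)).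
  by rewrite esum_swap// => k n; rewrite mule_ge0//; exact: powM_ge0.
apply: eq_esum => k _; rewrite esumZl//; last by move=> n; exact: powM_ge0.
by rewrite neumann_esum.
Qed.

Lemma neumann_mul_fix I L (T : emx R I I) (s : emx R I L) : ge0M T -> ge0M s ->
  mulM (neumann T) s = addM s (mulM T (mulM (neumann T) s)).
Proof.
move=> T0 s0; rewrite {1}neumannE// mulMDl//; last first.
  exact/mulM_ge0/neumann_ge0.
by rewrite mul1M// mulMA//; exact: neumann_ge0.
Qed.

(** For [t = 1] this says that [mulM (neumann T) s] is the least solution of
    [T y + s <= y]; [t > 1] allows to pass to the limit [t -> 1]. *)
Lemma neumann_partial_le I L (T : emx R I I) (s y : emx R I L) (t : R) (n : nat) l :
  ge0M T -> ge0M s -> ge0M y -> (1 <= t)%R ->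
  (forall i, mulM T y i l + s i l <= t%:E * y i l) ->
  forall i, \sum_(0 <= k < n) mulM (powM T k) s i l <= (t ^+ n)%:E * y i l.
Proof.
move=> T0 s0 y0 t1 sup; elim: n => [|n IHn] i.
  by rewrite big_nil expr0 mul1e.
have tn0 : 0 <= (t ^+ n)%:E by rewrite lee_fin exprn_ge0// (le_trans ler01).
(* Without its first term [s], the sum is [T] applied to the partial sum of length [n], which the
   induction hypothesis bounds by [t^n y]. Since [s <= t^n s], one use of [sup] supplies the last
   factor [t]. *)
rewrite big_nat_recl// mul1M//.
have -> : \sum_(0 <= k < n) mulM (powM T k.+1) s i l =
    \esum_(j in [set: I]) (T i j * \sum_(0 <= k < n) mulM (powM T k) s j l).
  transitivity (\sum_(0 <= k < n) \esum_(j in [set: I]) (T i j * mulM (powM T k) s j l)).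
    by apply: eq_bigr => k _; rewrite powMS mulMA//; exact: powM_ge0.
  rewrite -esum_sum; last by move=> j k _ _; rewrite mule_ge0// mulM_ge0//; exact: powM_ge0.
  apply: eq_esum => j _; rewrite ge0_sume_distrr// => k _.
  by apply: mulM_ge0 => //; exact: powM_ge0.
rewrite exprSr EFinM -muleA.
apply: le_trans (lee_wpmul2l tn0 (sup i)).
rewrite ge0_muleDr//; last exact: mulM_ge0.
rewrite addeC; apply: leeD; last first.
  by rewrite lee_pemull// lee_fin exprn_ege1.
rewrite /mulM -esumZl//; last by move=> j; exact: mule_ge0.
by apply: le_esum => j _; rewrite [leRHS]muleCA lee_wpmul2l// IHn.
Qed.

Lemma neumann_min I L (T : emx R I I) (s y : emx R I L) l :
  ge0M T -> ge0M s -> ge0M y -> (forall i, mulM T y i l + s i l <= y i l) ->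
  forall i, mulM (neumann T) s i l <= y i l.
Proof.
move=> T0 s0 y0 sup i.
have ps0 k : 0 <= mulM (powM T k) s i l by apply: mulM_ge0 => //; exact: powM_ge0.
rewrite neumann_mulE// -nneseries_esumT//; apply: lime_le.
  by apply: is_cvg_nneseries.
apply: nearW => n.
have := @neumann_partial_le I L T s y 1%R n l T0 s0 y0 (lexx _) _ i.
by rewrite expr1n mul1e; apply=> j; rewrite mul1e.
Qed.

Lemma powM_super I L (T : emx R I I) (y : emx R I L) (t : R) n l :
  ge0M T -> ge0M y -> (0 <= t)%R -> (forall i, mulM T y i l <= t%:E * y i l) ->
  forall i, mulM (powM T n) y i l <= (t ^+ n)%:E * y i l.
Proof.
move=> T0 y0 t0 sup; elim: n => [|n IHn] i; first by rewrite mul1M// expr0 mul1e.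
rewrite powMS mulMA//; last exact: powM_ge0.
have tn0 : 0 <= (t ^+ n)%:E by rewrite lee_fin exprn_ge0.
rewrite exprSr EFinM -muleA; apply: le_trans (lee_wpmul2l tn0 (sup i)).
rewrite /mulM -esumZl//; last by move=> j; exact: mule_ge0.
by apply: le_esum => j _; rewrite [leRHS]muleCA lee_wpmul2l// IHn.
Qed.

(** The source term [s] bounds those columns of [neumann T] where [s] does not
    vanish; the other columns are bounded by following a path to such a one. *)
Lemma neumann_finite I (T : emx R I I) (s y : emx R I unit) :
  ge0M T -> ge0M s -> ge0M y -> finiteM y ->
  (forall i, mulM T y i tt + s i tt <= y i tt) ->
  (forall i, exists2 j, 0 < neumann T i j & 0 < s j tt) ->
  finiteM (neumann T).
Proof.
move=> T0 s0 y0 fy sup reach i j.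
have N0 := neumann_ge0 T0.
have [k Njk sk] := reach j; have [n Tn] := neumann_gt0P T0 Njk.
have fin_col : neumann T i k < +oo.
  rewrite ltey; apply: contraTneq (neumann_min T0 s0 y0 sup i) => Nik.
  rewrite -ltNge (lt_le_trans _ (le_term_mulM i k tt N0 s0))//.
  by rewrite Nik gt0_mulye// ltey_eq fy.
(* A path from [j] to [k] transports the bound: [N i j * T^n j k] is at most the tail, from index
   [n] on, of the series for the finite [N i k]. *)
rewrite ge0_fin_numE// ltey; apply: contraTneq fin_col => Nij.
rewrite -leNgt -[leLHS](@gt0_mulye _ (powM T n j k))// -Nij.
apply: le_trans (le_term_mulM i j k N0 (powM_ge0 n T0)) _.
rewrite neumann_mulE//; last exact: powM_ge0.
rewrite -nneseries_esumT; last first.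
  by move=> p; apply: mulM_ge0; exact: powM_ge0.
under eq_eseriesr do rewrite -powM_add//.
rewrite (nneseries_addn (f := fun p => powM T p i k)); last by move=> p; exact: powM_ge0.
rewrite /neumann (@nneseries_split _ _ 0%N n)//= ?add0n ?leeDr ?sume_ge0// => p _;
  exact: powM_ge0.
Qed.

End NonnegativeMatrices.

(** * Perron-Frobenius theory *)

Section PerronFrobenius.
Variable R : realType.

Definition simplex m : set 'rV[R]_m :=
  [set x | (forall i, 0 <= x 0 i) /\ \sum_i x 0 i = 1].

Lemma coord_le1_simplex m (x : 'rV[R]_m) i : simplex x -> x 0 i <= 1.
Proof. by move=> [x0 <-]; rewrite (bigD1 i)//= lerDl sumr_ge0. Qed.

Lemma simplex_compact m : compact (@simplex m).
Proof.
apply: (@subclosed_compact _ _ [set v : 'rV[R]_m | forall i, `[0, 1]%classic (v ord0 i)]).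
- have -> : @simplex m = \bigcap_(i in [set: 'I_m]) [set x | 0 <= x 0 i] `&`
      [set x | \sum_i x 0 i = 1].
    apply/seteqP; split=> x [x0 x1]; split=> // i; last exact: x0.
    by move=> _; exact: x0.
  apply: closedI.
    apply: closed_bigI => i _.
    apply: (@preimage_closed _ _ (fun x : 'rV[R]_m => x 0 i) [set y | 0 <= y]).
      by move=> x _; exact: coord_continuous.
    exact: closed_ge.
  apply: (@preimage_closed _ _ (fun x : 'rV[R]_m => \sum_i x 0 i) [set y | y = 1]).
    move=> x _; apply: continuous_big; first exact: add_continuous.
    by move=> i _; exact: coord_continuous.
  exact: closed_eq.
- by have := @rV_compact R m (fun=> `[0, 1]%classic); apply=> _; exact: segment_compact.
- move=> x xS i /=; rewrite in_itv/= (coord_le1_simplex i xS) andbT.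
  by case: xS.
Qed.

(** Compactness turns approximate solutions into an exact one: the total violation [f] is continuous
    and attains its minimum, and a positive minimum would be undercut. *)
Lemma simplex_limit m (F : 'I_m -> 'rV[R]_m -> R) :
  (forall i, continuous (F i)) ->
  (forall e, 0 < e -> exists2 x, simplex x & forall i, F i x <= e) ->
  exists2 x, simplex x & forall i, F i x <= 0.
Proof.
move=> Fc Fe.
pose f x := \sum_i Num.max (F i x) 0.
have fc : continuous f.
  apply: continuous_big; first exact: add_continuous.
  move=> i _; apply: max_fun_continuous; first exact: Fc.
  exact: cst_continuous.
have [x0 x0S _] := Fe 1 ltr01.
have [||c cS cmin] := @EVT_min_rV R m f (@simplex m) _ (@simplex_compact m).
- by exists x0.
- exact: continuous_subspaceT.
exists c; first by rewrite inE in cS.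
have f0 x i : F i x <= f x.
  rewrite /f (bigD1 i)//= (@le_trans _ _ (Num.max (F i x) 0))// ?le_max ?lexx//.
  by rewrite lerDl sumr_ge0// => j _; rewrite le_max lexx orbT.
have fc0 : f c <= 0.
  rewrite leNgt; apply/negP => fc_gt0.
  (* Division by [m.+1] keeps the sum of the [m] coordinate violations strictly below [f c]. *)
  have e0 : 0 < f c / m.+1%:R by rewrite divr_gt0.
  have [x xS Fx] := Fe _ e0.
  have /cmin : x \in @simplex m by rewrite inE.
  apply/negP; rewrite -ltNge.
  apply: (@le_lt_trans _ _ (\sum_(i < m) f c / m.+1%:R)).
    by apply: ler_sum => i _; rewrite ge_max Fx ltW.
  rewrite sumr_const card_ord -mulrnAr -ltr_pdivlMl// mulVf ?gt_eqF//.
  by rewrite -mulr_natl ltr_pdivrMr ?mul1r ?ltr_nat.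
by move=> i; apply: le_trans fc0; exact: f0.
Qed.

Definition app m (T : 'M[R]_m) (x : 'I_m -> R) (i : 'I_m) : R := \sum_j T i j * x j.

Lemma le_app m (T : 'M[R]_m) x y : nonneg_mx T -> (forall i, x i <= y i) ->
  forall i, app T x i <= app T y i.
Proof. by move=> T0 xy i; apply: ler_sum => j _; exact: ler_wpM2l. Qed.

Lemma appZ m (T : 'M[R]_m) (c : R) x i : app T (fun j => c * x j) i = c * app T x i.
Proof. by rewrite /app mulr_sumr; apply: eq_bigr => j _; rewrite mulrCA. Qed.

Lemma appB m (T : 'M[R]_m) x y i : app T (fun j => x j - y j) i = app T x i - app T y i.
Proof. by rewrite /app -sumrB; apply: eq_bigr => j _; rewrite mulrBr. Qed.

Lemma app_ge0 m (T : 'M[R]_m) x i : nonneg_mx T -> (forall i, 0 <= x i) -> 0 <= app T x i.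
Proof. by move=> T0 x0; apply: sumr_ge0 => j _; exact: mulr_ge0. Qed.

(** The witness [1 / (1 + sum of 1 / a i)] needs no minimum over ['I_m], which may be empty. *)
Lemma finite_pos_lb m (a : 'I_m -> R) : (forall i, 0 < a i) ->
  exists2 d, 0 < d & forall i, d <= a i.
Proof.
move=> a0; pose s := \sum_i (a i)^-1.
have s0 : 0 <= s by apply: sumr_ge0 => i _; rewrite invr_ge0 ltW.
exists (s + 1)^-1; first by rewrite invr_gt0 ltr_wpDl.
move=> i; rewrite -[leRHS]invrK lef_pV2 ?posrE ?invr_gt0 ?ltr_wpDl//.
rewrite /s (bigD1 i)//= -addrA lerDl addr_ge0// sumr_ge0// => j _.
by rewrite invr_ge0 ltW.
Qed.

Lemma finite_ub m (a : 'I_m -> R) : exists2 d, 0 < d & forall i, a i <= d.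
Proof.
have s0 : 0 <= \sum_i `|a i| by apply: sumr_ge0.
exists (\sum_i `|a i| + 1); first by rewrite ltr_wpDl.
move=> i; rewrite (le_trans (ler_norm _))// (bigD1 i)//= -addrA lerDl addr_ge0//.
by rewrite sumr_ge0.
Qed.

(** Compare [x] with [c *: y] at the index where [x / y] is maximal. *)
Lemma sub_super_le m (T : 'M[R]_m) (x y : 'I_m -> R) (r t : R) :
  nonneg_mx T -> (forall i, 0 <= x i) -> (exists i, 0 < x i) ->
  (forall i, r * x i <= app T x i) ->
  (forall i, 0 < y i) -> (forall i, app T y i <= t * y i) -> r <= t.
Proof.
move=> T0 x0 [i0 xi0] rx y0 ty.
pose i := [arg max_(i > i0) (x i / y i)%O]%O.
have imax j : x j / y j <= x i / y i.
  by rewrite /i; case: arg_maxP => // k _ kmax; exact: kmax.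
have xi : 0 < x i.
  have : 0 < x i / y i by apply: lt_le_trans (imax i0); rewrite divr_gt0.
  by rewrite pmulr_lgt0// invr_gt0.
rewrite -(ler_pM2r xi); apply: le_trans (rx i) _.
apply: (@le_trans _ _ (app T (fun j => x i / y i * y j) i)).
  by apply: le_app => // j; rewrite -ler_pdivrMr.
rewrite appZ; apply: (@le_trans _ _ (x i / y i * (t * y i))).
  by apply: ler_wpM2l (ty i); rewrite divr_ge0// ltW.
by rewrite mulrCA -mulrA mulVf ?mulr1// gt_eqF.
Qed.

Lemma simplex_nz m (x : 'rV[R]_m) : simplex x -> exists i, 0 < x 0 i.
Proof.
move=> [x0 x1]; apply: contrapT => /forallNP nx.
have := x1; rewrite big1; first by move/esym/eqP; rewrite oner_eq0.
move=> i _; apply/eqP; rewrite eq_le x0 andbT leNgt; exact/negP.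
Qed.

Lemma app_continuous m (T : 'M[R]_m) i : continuous (fun x : 'rV[R]_m => app T (x 0) i).
Proof.
apply: continuous_big; first exact: add_continuous.
move=> j _ x; apply: continuousM; [exact: cst_continuous|exact: coord_continuous].
Qed.

Lemma residual_continuous m (T : 'M[R]_m) r i :
  continuous (fun x : 'rV[R]_m => r * x 0 i - app T (x 0) i).
Proof.
move=> x.
have c1 : {for x, continuous (fun x : 'rV[R]_m => r * x 0 i)}.
  by apply: continuousM; [exact: cst_continuous|exact: coord_continuous].
have c2 := @app_continuous m T i x.
exact: (@continuousB R R^o _ _ _ _ c1 c2).
Qed.

Lemma simplex_normalize m (y : 'I_m -> R) : (0 < m)%N -> (forall i, 0 < y i) ->
  exists2 c, 0 < c & simplex (\row_i (c * y i)).
Proof.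
move=> m0 y0; have s0 : 0 < \sum_i y i.
  rewrite (bigD1 (Ordinal m0))//= ltr_pwDl// sumr_ge0// => i _; exact: ltW.
exists (\sum_i y i)^-1; first by rewrite invr_gt0.
split=> [i|]; first by rewrite mxE mulr_ge0// ?invr_ge0 ltW.
under eq_bigr do rewrite mxE.
by rewrite -mulr_sumr mulVf// gt_eqF.
Qed.

(** Collatz-Wielandt argument: [r] is the largest factor with [r x <= T x] on the simplex. If a
    maximizing [x] were not an eigenvector, positivity of [T] would make [T (T x)] strictly larger
    than [r T x] in every coordinate, and [r] could be raised. *)
Lemma perron_pos m (T : 'M[R]_m) : (0 < m)%N -> (forall i j, 0 < T i j) ->
  exists r, exists2 x, simplex x &
    (forall i, 0 < x 0 i) /\ forall i, app T (x 0) i = r * x 0 i.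
Proof.
move=> m0 Tp; have T0 : nonneg_mx T by move=> i j; exact: ltW.
pose S := [set r | exists2 x, simplex x & forall i, r * x 0 i <= app T (x 0) i].
have appT_gt0 x i : (forall i, 0 <= x i) -> (exists i, 0 < x i) -> 0 < app T x i.
  move=> x0 [j xj]; rewrite /app (bigD1 j)//= ltr_pwDl ?mulr_gt0//.
  by rewrite sumr_ge0// => k _; rewrite mulr_ge0.
have S0 : S 0.
  have [//|c c0 cS] := @simplex_normalize m (fun=> 1) m0.
  exists (\row_i (c * 1)) => // i; rewrite mul0r; apply: app_ge0 => //.
  by case: cS.
have supS : has_sup S.
  split; first by exists 0.
  have [d _ dub] := finite_ub (fun i => \sum_j T i j).
  exists d => r [x xS rx]; have [x0 _] := xS.
  apply: (@sub_super_le m T (x 0) (fun=> 1)) => //; first exact: simplex_nz.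
  move=> i; rewrite mulr1; apply: le_trans (dub i).
  by apply: ler_sum => j _; rewrite mulr1.
pose r := sup S.
(* The supremum is attained: a witness for a factor within [e] of [r] violates the inequality for
   [r] by at most [e], because coordinates on the simplex are at most [1]. *)
have [i|e e0|x xS xr] := @simplex_limit m (fun i x => r * x 0 i - app T (x 0) i).
- exact: residual_continuous.
- have [p [x xS px] rp] := sup_adherent e0 supS.
  exists x => // i; rewrite lerBlDr.
  apply: (@le_trans _ _ ((e + p) * x 0 i)).
    by rewrite ler_wpM2r ?(proj1 xS)// -lerBlDl; apply: ltW.
  by rewrite mulrDl lerD//; apply: ler_piMr; [exact: ltW|exact: coord_le1_simplex].
have r0 : 0 <= r by apply: sup_ubound => //; case: supS.
have [x0 _] := xS.
have rx i : r * x 0 i <= app T (x 0) i by rewrite -subr_le0.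
suff eqx i : app T (x 0) i = r * x 0 i.
  exists r, x => //; split=> // i.
  rewrite lt_def x0 andbT; apply: contraTneq (appT_gt0 _ i x0 (simplex_nz xS)) => xi.
  by rewrite eqx xi mulr0 ltxx.
apply: contrapT => neq.
pose z j := app T (x 0) j - r * x 0 j.
have z0 j : 0 <= z j by rewrite subr_ge0.
have zi : 0 < z i by rewrite lt_def z0 andbT subr_eq0; apply/eqP.
pose y := app T (x 0).
have y0 j : 0 < y j by apply: appT_gt0 => //; exact: simplex_nz.
have Tz j : 0 < app T z j by apply: appT_gt0 => //; exists i.
(* [d] is the gain: [T z = T y - r y >= d y]. *)
have [d d0 dle] := finite_pos_lb (fun j => divr_gt0 (Tz j) (y0 j)).
suff : S (r + d).
  move=> /(sup_upper_bound supS); rewrite -/r gerDl leNgt; exact/negP/negPn.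
have [c c0 cS] := simplex_normalize m0 y0.
exists (\row_i (c * y i)) => // j.
have -> : app T ((\row_i (c * y i)) 0) j = c * app T y j.
  by rewrite -appZ; apply: eq_bigr => k _; rewrite mxE.
rewrite mxE mulrCA ler_pM2l// mulrDl.
have /(_ j) := dle; rewrite ler_pdivlMr// => /(lerD (lexx (r * y j))) /le_trans; apply.
by rewrite /z appB appZ addrC subrK.
Qed.

(** [T] is the limit of the positive matrices [T + e]; the eigenvalue is the
    infimum of the [t] admitting a positive [x] with [T x <= t x]. *)
Theorem perron_frobenius m (T : 'M[R]_m) : (0 < m)%N -> nonneg_mx T ->
  exists2 r, 0 <= r &
    (exists2 x, simplex x & forall i, app T (x 0) i = r * x 0 i) /\
    (forall t, r < t -> exists2 x : 'I_m -> R, (forall i, 0 < x i) &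
       forall i, app T x i <= t * x i).
Proof.
move=> m0 T0.
pose S := [set t | exists2 x : 'I_m -> R, (forall i, 0 < x i) &
       forall i, app T x i <= t * x i].
have Sge0 t : S t -> 0 <= t.
  move=> [x x0 xt]; pose i := Ordinal m0.
  have : 0 <= t * x i.
    by apply: le_trans (xt i); apply: app_ge0 => // j; exact: ltW.
  by rewrite pmulr_lge0.
have infS : has_inf S.
  split; last by exists 0.
  have [d d0 dub] := finite_ub (fun i => \sum_j T i j).
  exists d; exists (fun=> 1) => // i; rewrite mulr1; apply: le_trans (dub i).
  by apply: ler_sum => j _; rewrite mulr1.
pose r := inf S.
have r0 : 0 <= r by apply: lb_le_inf; [case: infS|exact: Sge0].
exists r => //; split; last first.
  move=> t rt; have e0 : 0 < t - r by rewrite subr_gt0.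
  have [p [x x0 px]] := inf_adherent e0 infS; rewrite -/r addrC subrK => pt.
  exists x => // i; apply: le_trans (px i) _.
  by rewrite ler_wpM2r// ltW.
have [i|e e0|x xS xr] := @simplex_limit m (fun i x => `|r * x 0 i - app T (x 0) i|).
- move=> x; exact: (continuous_comp (@residual_continuous m T r i x) (@norm_continuous R R^o _)).
- have e20 : 0 < e / 2 by rewrite divr_gt0.
  have [p [y y0 py]] := inf_adherent e20 infS; rewrite -/r => pr.
  have [C C0 Cub] := finite_ub (fun i => (\sum_j y j) / y i).
  (* The second bound makes [d * sum y <= (e / 2) y i], so that [U y <= (p + e / 2) y <= (r + e) y]
     and hence [q <= r + e]. The first bound keeps the perturbation itself below [e]. *)
  pose d := Num.min (e / 2) (e / 2 / C).
  have d0 : 0 < d by rewrite lt_min e20 divr_gt0.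
  pose U : 'M[R]_m := T + const_mx d.
  have Up i j : 0 < U i j by rewrite !mxE ltr_wpDl.
  have U0 : nonneg_mx U by move=> i j; exact: ltW.
  have appU x i : app U x i = app T x i + d * \sum_j x j.
    rewrite /app mulr_sumr -big_split/=; apply: eq_bigr => j _.
    by rewrite !mxE mulrDl.
  have [q [x xS [xp qx]]] := perron_pos m0 Up.
  have [x0 x1] := xS.
  (* Since [T <= U], the Perron vector of [U] shows that [q] is in [S]. *)
  have rq : r <= q.
    apply: (inf_lbound (proj2 infS)); exists (x 0) => // i.
    by rewrite -qx appU lerDl mulr_ge0 ?sumr_ge0// ltW.
  have qr : q <= r + e.
    apply: (@sub_super_le m U (x 0) y) => //.
    - exact: simplex_nz.
    - by move=> i; rewrite qx.
    - move=> i; rewrite appU.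
      have -> : e = e / 2 + e / 2 by rewrite -splitr.
      rewrite addrA mulrDl lerD//.
        by apply: le_trans (py i) _; rewrite ler_wpM2r// ltW.
      rewrite -ler_pdivrMr// -mulrA.
      apply: (@le_trans _ _ (e / 2 / C * C)); last by rewrite divfK// gt_eqF.
      apply: ler_pM; [exact: ltW| |by rewrite /d ge_min lexx orbT|exact: Cub].
      by rewrite divr_ge0 ?sumr_ge0// => [j _|]; exact: ltW.
  exists x => // i.
  rewrite distrC; have -> : app T (x 0) i - r * x 0 i = (q - r) * x 0 i - d.
    have := qx i; rewrite appU x1 mulr1 mulrBl => <-.
    by rewrite addrAC addrK.
  have de : d <= e.
    by rewrite ge_min ler_pdivrMr// ler_pMr// ler1n.
  rewrite ler_norml lerBlDr; apply/andP; split.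
    rewrite -[leLHS]add0r lerD// ?lerN2//.
    by rewrite mulr_ge0// subr_ge0.
  apply: (@le_trans _ _ (q - r)).
    by rewrite ler_piMr ?subr_ge0// coord_le1_simplex.
  apply: (@le_trans _ _ e); first by rewrite lerBlDl.
  by rewrite lerDl ltW.
exists x => // i; apply/eqP; rewrite eq_sym -subr_eq0 -normr_eq0 eq_le normr_ge0 andbT.
exact: xr.
Qed.

End PerronFrobenius.

(** In the sum norm with weights [x], multiplying a row vector by [T] stretches it by at most [t];
    this is applied to a left eigenvector. A general field covers real and complex eigenvalues at
    once. *)
Lemma eigenvalue_norm_le (C : numFieldType) m (T : 'M[C]_m) (x : 'I_m -> C) (t z : C) :
  (forall i j, 0 <= T i j) -> (forall i, 0 < x i) ->
  (forall i, \sum_j T i j * x j <= t * x i) -> eigenvalue T z -> `|z| <= t.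
Proof.
move=> T0 x0 xt /eigenvalueP[v vT v0].
have [i vi] : exists i, v 0 i != 0.
  apply: contrapT => /forallNP nv; case/eqP: v0; apply/rowP => i.
  by rewrite mxE; apply/eqP; rewrite -[_ == _]negbK; exact/negP.
have s0 : 0 < \sum_j `|v 0 j| * x j.
  rewrite (bigD1 i)//= ltr_pwDl ?mulr_gt0 ?normr_gt0// sumr_ge0// => j _.
  by rewrite mulr_ge0// ltW.
rewrite -(ler_pM2r s0) !mulr_sumr.
apply: (@le_trans _ _ (\sum_j (\sum_i `|v 0 i| * T i j) * x j)).
  apply: ler_sum => j _; rewrite mulrA; apply: ler_wpM2r; first exact: ltW.
  have /rowP/(_ j) := vT; rewrite !mxE -normrM => <-.
  apply: (le_trans (ler_norm_sum _ _ _)); apply: ler_sum => k _.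
  by rewrite normrM (ger0_norm (T0 _ _)).
under eq_bigr do rewrite mulr_suml.
rewrite exchange_big/=; apply: ler_sum => k _.
under eq_bigr do rewrite -mulrA.
by rewrite -mulr_sumr mulrCA ler_wpM2l.
Qed.

(** * Identification of [gamma_pf] with the Perron root *)

Section PFEigenvalue.
Variable R : realType.

Lemma pf_le_super m (T : 'M[R]_m) (x : 'I_m -> R) (t : R) :
  nonneg_mx T -> 0 <= t -> (forall i, 0 < x i) -> (forall i, app T x i <= t * x i) ->
  gamma_pf T <= t.
Proof.
(* The default value [0] of [xget] is covered by [0 <= t]. *)
move=> T0 t0 x0 xt; rewrite /gamma_pf; case: xgetP => // r _ [er _].
by apply: le_trans (ler_norm _) _; exact: eigenvalue_norm_le er.
Qed.

Lemma pf_eigenvalue_le m (T : 'M[R]_m) (r s : R) :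
  is_pf_eigenvalue T r -> is_pf_eigenvalue T s -> r <= s.
Proof.
move=> [er _] [_ ds]; have := ds (real_complex R r).
rewrite eigenvalue_map => /(_ er).
by rewrite normc_def/= expr0n/= addr0 sqrtr_sqr lecR; apply: le_trans; exact: ler_norm.
Qed.

(** [eigenvalue] refers to row vectors, whereas the Perron vectors above are columns; transposition
    keeps the characteristic polynomial. *)
Lemma eigenvalue_tr (F : fieldType) m (T : 'M[F]_m) a :
  eigenvalue T^T a = eigenvalue T a.
Proof.
rewrite !eigenvalue_root_char; congr (root _ a).
by rewrite /char_poly -det_tr /char_poly_mx linearB/= map_trmx tr_scalar_mx trmxK.
Qed.

(** The root given by [perron_frobenius] dominates every complex eigenvalue because positive
    supersolutions exist for [r + e] with every [e > 0]. Uniqueness identifies it with the value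
    chosen by [xget]. *)
Lemma gamma_pfP m (T : 'M[R]_m) : (0 < m)%N -> nonneg_mx T ->
  (exists2 x, simplex x & forall i, app T (x 0) i = gamma_pf T * x 0 i) /\
  (forall t, gamma_pf T < t -> exists2 x : 'I_m -> R, (forall i, 0 < x i) &
       forall i, app T x i <= t * x i).
Proof.
move=> m0 T0; have [r r0 [[h hS rh] super]] := perron_frobenius m0 T0.
suff pfr : is_pf_eigenvalue T r.
  suff -> : gamma_pf T = r by split=> //; exists h.
  by apply: xget_unique => // s pfs; apply: le_anti; rewrite !(@pf_eigenvalue_le _ T).
split.
  rewrite -eigenvalue_tr; apply/eigenvalueP; exists h.
    apply/rowP => i; rewrite !mxE -rh; apply: eq_bigr => j _.
    by rewrite mxE mulrC.
  have [i hi] := simplex_nz hS; apply: contraTneq hi => ->.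
  by rewrite mxE ltxx.
move=> z ez; rewrite normc_def lecR; apply/ler_addgt0Pr => e e0.
have [x x0 xt] := super (r + e) (ltr_pwDr e0 (lexx r)).
rewrite -lecR -normc_def.
apply: (@eigenvalue_norm_le _ m _ (fun i => real_complex R (x i))) ez.
- by move=> i j; rewrite mxE ler0c.
- by move=> i; rewrite ltcR.
- move=> i; rewrite -rmorphM/=.
  under eq_bigr do rewrite mxE -rmorphM/=.
  by rewrite -rmorph_sum lecR; exact: xt.
Qed.

End PFEigenvalue.

(** * Convergence parameter *)

Section ConvergenceParameter.
Variable R : realType.
Local Open Scope ereal_scope.
Variables (I : choiceType) (T : emx R I I).
Hypothesis T0 : ge0M T.

(** Absorbs [u ^ n] into the matrix, so that convergence at [u] becomes finiteness of a Neumann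
    series. *)
Definition scaleM (u : R) : emx R I I := fun i j => u%:E * T i j.

Lemma scaleM_ge0 u : (0 <= u)%R -> ge0M (scaleM u).
Proof. by move=> u0 i j; rewrite mule_ge0// lee_fin. Qed.

Lemma mulM_scale (L : choiceType) u (y : emx R I L) i l : (0 <= u)%R -> ge0M y ->
  mulM (scaleM u) y i l = u%:E * mulM T y i l.
Proof.
move=> u0 y0; rewrite /mulM -esumZl ?lee_fin//; last by move=> j; exact: mule_ge0.
by apply: eq_esum => j _; rewrite muleA.
Qed.

Lemma powM_scale u n i j : (0 <= u)%R ->
  powM (scaleM u) n i j = (u ^+ n)%:E * powM T n i j.
Proof.
move=> u0; elim: n i => [|n IHn] i; first by rewrite expr0 mul1e.
rewrite !powMS mulM_scale//; last exact/powM_ge0/scaleM_ge0.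
rewrite exprS EFinM -muleA; congr (_ * _).
rewrite /mulM -esumZl ?lee_fin ?exprn_ge0//; last first.
  by move=> k; rewrite mule_ge0//; exact: powM_ge0.
by apply: eq_esum => k _; rewrite IHn muleCA.
Qed.

Lemma neumann_scale u i j : (0 <= u)%R ->
  neumann (scaleM u) i j = \sum_(0 <= n <oo) ((u ^+ n)%:E * powM T n i j).
Proof. by move=> u0; apply: eq_eseriesr => n _; rewrite powM_scale. Qed.

Lemma conv_paramE : conv_param T =
  ereal_sup [set u%:E | u in [set u : R | (0 <= u)%R /\
    forall i j, neumann (scaleM u) i j < +oo]].
Proof.
rewrite /conv_param; congr (ereal_sup (_ @` _)).
by apply/seteqP; split=> u [u0 fin]; split=> // i j; have := fin i j;
  rewrite neumann_scale.
Qed.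

(** Given [v < 1], a supersolution with a factor [t] such that [v t < 1] leaves the positive slack
    [(1 - v t) y]. Taken as a source term, this slack bounds all entries of the resolvent at [v]. *)
Lemma conv_param_ge1 :
  (forall t : R, (1 < t)%R -> exists y : emx R I unit,
     [/\ ge0M y, finiteM y, forall i, 0 < y i tt &
         forall i, mulM T y i tt <= t%:E * y i tt]) ->
  1 <= conv_param T.
Proof.
move=> ex; rewrite conv_paramE.
have ltv (v : R) : (0 <= v)%R -> (v < 1)%R -> forall i j, neumann (scaleM v) i j < +oo.
  move=> v0 v1 i j.
  (* This value satisfies both [1 < t] and [v t < 1]. *)
  have t1 : (1 < 2 / (1 + v))%R.
    by rewrite ltr_pdivlMr; lra.
  have [y [y0 fy y_gt0 ty]] := ex _ t1.
  set t := (2 / (1 + v))%R in t1 ty.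
  have vt1 : (v * t < 1)%R.
    by rewrite /t mulrA ltr_pdivrMr; lra.
  have w0 : (0 < 1 - v * t)%R by rewrite subr_gt0.
  have sup k : mulM (scaleM v) y k tt + (1 - v * t)%:E * y k tt <= y k tt.
    rewrite mulM_scale//.
    apply: (@le_trans _ _ (v%:E * (t%:E * y k tt) + (1 - v * t)%:E * y k tt)).
      by rewrite leeD2r// lee_wpmul2l// lee_fin.
    rewrite muleA -EFinM -ge0_muleDl ?lee_fin; last 2 first.
    - by rewrite mulr_ge0// ltW// (lt_trans _ t1).
    - exact: ltW.
    by rewrite -EFinD addrC subrK mul1e.
  have s0 : ge0M (fun k (_ : unit) => (1 - v * t)%:E * y k tt).
    by move=> k _; rewrite mule_ge0// lee_fin ltW.
  have sv0 := scaleM_ge0 v0.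
  have := neumann_min sv0 s0 y0 sup i.
  move/(le_trans (le_term_mulM i j tt (neumann_ge0 sv0) s0)) => le_y.
  rewrite ltey; apply: contraTneq le_y => ->.
  by rewrite gt0_mulye ?mule_gt0 ?lte_fin// -ltNge ltey_eq fy.
have sup_ge (v : R) : (0 <= v)%R -> (v < 1)%R ->
    v%:E <= ereal_sup [set u%:E | u in [set u : R | (0 <= u)%R /\
    forall i j, neumann (scaleM u) i j < +oo]].
  by move=> v0 v1; apply: ereal_sup_ubound; exists v => //; split => //; exact: ltv.
apply/lee_subgt0Pr => e e0.
rewrite -EFinB; have [e1|e1] := ltP e 1%R.
  by apply: sup_ge; [rewrite subr_ge0 ltW|rewrite ltrBlDr ltrDl].
(* For [e >= 1] the point [v = 0] suffices. *)
apply: (@le_trans _ _ 0%R%:E); first by rewrite lee_fin subr_le0.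
exact: sup_ge.
Qed.

(** The vector is column [o] of the resolvent: the identity term of the Neumann series gives the
    value at [o], and dropping that term gives the inequality. *)
Lemma resolvent_super (u : R) (o : I) :
  (0 <= u)%R -> (forall i j, neumann (scaleM u) i j < +oo) ->
  exists y : emx R I unit,
    [/\ ge0M y, finiteM y, 1 <= y o tt & forall i, u%:E * mulM T y i tt <= y i tt].
Proof.
move=> u0 fin; have su0 := scaleM_ge0 u0.
pose y : emx R I unit := fun i _ => neumann (scaleM u) i o.
have y0 : ge0M y by move=> i j; exact: neumann_ge0.
exists y; split=> //.
- by move=> i k; rewrite ge0_fin_numE ?fin//; exact: y0.
- apply: le_trans (le_powM_neumann 0 o o su0).
  by rewrite /powM/= /idM eqxx.
- move=> i; rewrite -mulM_scale//.
  rewrite /y [leRHS](_ : _ = addM (@idM R I) (mulM (scaleM u) (neumann (scaleM u))) i o).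
    by rewrite /addM leeDr//; exact: idM_ge0.
  by rewrite -neumannE.
Qed.

Lemma conv_param_gt (t : R) : (t%:E < conv_param T) ->
  exists2 u : R, (t < u)%R & (0 <= u)%R /\ forall i j, neumann (scaleM u) i j < +oo.
Proof.
rewrite conv_paramE => /ereal_sup_gt[_ [u [u0 fin] <-]]; rewrite lte_fin => tu.
by exists u.
Qed.

Lemma le_of_pow_le (p : \bar R) (n : nat) :
  (forall t : R, (1 < t)%R -> p <= (t ^+ n)%:E) -> p <= 1.
Proof.
move=> pt; rewrite leNgt; apply/negP => p1.
have [s s1 sp] : exists2 s : R, (1 < s)%R & s%:E < p.
  case: p p1 {pt} => [p| |]//=.
  - rewrite lte_fin => p1; exists ((1 + p) / 2)%R.
      by rewrite midf_lt.
    by rewrite lte_fin midf_lt.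
  - by move=> _; exists 2%R; [rewrite ltr1n|rewrite ltry].
(* A root of order [n.+1] also serves [n = 0]; then [t^n <= t^(n+1) = s < p] contradicts the assumed
   bound. *)
pose t := (s `^ (n.+1%:R^-1))%R.
have s0 : (0 < s)%R by apply: lt_trans s1.
have tn : (t ^+ n.+1 = s)%R.
  by rewrite /t -powR_mulrn ?powR_ge0// -powRrM mulVf ?powRr1 ?ltW// pnatr_eq0.
have t1 : (1 < t)%R.
  rewrite ltNge; apply/negP => t1; have : (t ^+ n.+1 <= 1)%R.
    by rewrite exprn_ile1// powR_ge0.
  by rewrite tn leNgt s1.
have : p <= s%:E.
  apply: le_trans (pt t t1) _; rewrite lee_fin -tn exprSr.
  by rewrite ler_peMr ?exprn_ge0 ?powR_ge0// ltW.
by rewrite leNgt sp.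
Qed.

Hypothesis T_irr : forall i j, exists n, 0 < powM T n i j.
Hypothesis conv1 : 1 <= conv_param T.

(** The subinvariant vector is [1] at [o] and elsewhere [F i], the total weight
    of the first passages from [i] to [o] (paths of the taboo matrix, whose column
    [o] is zero): it is the monotone limit at [u = 1] of the normalized resolvent
    columns. *)
Lemma subinvariant_vector (o : I) : exists y : emx R I unit,
  [/\ ge0M y, finiteM y, forall i, 0 < y i tt & forall i, mulM T y i tt <= y i tt].
Proof.
pose U : emx R I I := fun i j => if j == o then 0 else T i j.
pose c : emx R I unit := fun i _ => T i o.
have U0 : ge0M U by move=> i j; rewrite /U; case: ifP.
have c0 : ge0M c by move=> i j; exact: T0.
have split_o (y : emx R I unit) i : ge0M y ->
    mulM T y i tt = mulM U y i tt + c i tt * y o tt.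
  move=> y0; rewrite /mulM -[c i tt * _](@esum_if1 _ _ _ o); last exact: mule_ge0.
  rewrite -esumD; last 2 first.
  - by move=> j _; exact: mule_ge0.
  - by move=> j _; case: ifP => // _; exact: mule_ge0.
  apply: eq_esum => j _; rewrite /U; case: eqVneq => [->|_].
    by rewrite mul0e add0e.
  by rewrite adde0.
pose F := mulM (neumann U) c.
have F0 : ge0M F by apply: mulM_ge0 => //; exact: neumann_ge0.
(* The resolvent column at some [u > 1 / t] satisfies [U y + c y(o) <= t y]. With source [c y(o)]
   the partial sums are at most [t^n y(o)], and the positive finite [y(o)] cancels. *)
have partial_le n (t : R) : (1 < t)%R ->
    \sum_(0 <= k < n) mulM (powM U k) c o tt <= (t ^+ n)%:E.
  move=> t1; have t0 : (0 < t)%R by apply: lt_trans t1.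
  have [|u tu [u0 fin]] := @conv_param_gt t^-1.
    by apply: lt_le_trans conv1; rewrite lte_fin invf_lt1.
  have u_gt0 : (0 < u)%R by apply: lt_trans tu; rewrite invr_gt0.
  have [y [y0 fy yo1 uy]] := resolvent_super o u0 fin.
  have yo_gt0 : 0 < y o tt by apply: lt_le_trans yo1.
  have ty i : mulM T y i tt <= t%:E * y i tt.
    rewrite -lee_pdivrMl//; apply: le_trans (uy i).
    by apply: lee_wpmul2r; [exact: mulM_ge0|rewrite lee_fin ltW].
  pose s : emx R I unit := fun i _ => c i tt * y o tt.
  have s0 : ge0M s by move=> i j; exact: mule_ge0.
  have := @neumann_partial_le _ _ _ U s y t n tt U0 s0 y0 (ltW t1) _ o.
  have -> : \sum_(0 <= k < n) mulM (powM U k) s o tt =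
      (\sum_(0 <= k < n) mulM (powM U k) c o tt) * y o tt.
    rewrite ge0_sume_distrl; last first.
      by move=> k _; apply: mulM_ge0 => //; exact: powM_ge0.
    apply: eq_bigr => k _; rewrite /mulM -esumZr//; last first.
      by move=> j; rewrite mule_ge0//; exact: powM_ge0.
    by apply: eq_esum => j _; rewrite /s muleA.
  rewrite lee_pmul2r//.
  by apply=> i; rewrite -split_o.
(* First [t] tends to [1] with [n] fixed, then [n] grows. *)
have Fo1 : F o tt <= 1.
  have m0 k : 0 <= mulM (powM U k) c o tt by apply: mulM_ge0 => //; exact: powM_ge0.
  rewrite /F neumann_mulE// -nneseries_esumT//; apply: lime_le.
    exact: is_cvg_nneseries.
  by apply: nearW => n; apply: (@le_of_pow_le _ n) => t; exact: partial_le.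
pose y : emx R I unit := fun i _ => if i == o then 1 else F i tt.
have y0 : ge0M y by move=> i j; rewrite /y; case: ifP.
(* [T y] equals [F] everywhere, and [y] can differ from [F] only at [o], where [F o <= 1]. *)
have Ty i : mulM T y i tt <= y i tt.
  have -> : mulM T y i tt = F i tt.
    rewrite split_o// {2}/y eqxx mule1 addeC.
    rewrite /F neumann_mul_fix// -/F /addM; congr (_ + _).
    by apply: eq_esum => j _; rewrite /U /y; case: ifP; rewrite ?mul0e.
  by rewrite /y; case: eqVneq => [->|].
(* Paths give the two remaining properties: one from [o] to [i] makes [y i] finite, one from [i] to
   [o] makes it positive. *)
have pow_le n i j : powM T n i j * y j tt <= y i tt.
  have := @powM_super _ _ _ T y 1%R n tt T0 y0 ler01 _ i.
  rewrite expr1n mul1e => /(_ _)/(le_trans (le_term_mulM i j tt (powM_ge0 n T0) y0)).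
  by apply=> k; rewrite mul1e.
exists y; split=> //.
- move=> i []; have [n Tn] := T_irr o i.
  have := pow_le n o i; rewrite {2}/y eqxx => le1.
  rewrite ge0_fin_numE//; rewrite ltey; apply: contraTneq le1 => ->.
  by rewrite gt0_muley// -ltNge ltry.
- move=> i; have [n Tn] := T_irr i o; apply: lt_le_trans (pow_le n i o).
  by rewrite /y eqxx mule1.
Qed.

End ConvergenceParameter.

(** * Quasi-birth-and-death matrices *)

Section RealVectors.
Variable R : realType.
Local Open Scope ereal_scope.

Definition col_emx m (x : 'I_m -> R) : emx R 'I_m unit := fun i _ => (x i)%:E.

Lemma of_mx_ge0 m n (A : 'M[R]_(m, n)) : nonneg_mx A -> ge0M (of_mx A).
Proof. by move=> A0 i j; rewrite lee_fin. Qed.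

Lemma col_emx_ge0 m (x : 'I_m -> R) : (forall i, (0 <= x i)%R) -> ge0M (col_emx x).
Proof. by move=> x0 i j; rewrite lee_fin. Qed.

Lemma mulM_col m (A : 'M[R]_m) (x : 'I_m -> R) i : nonneg_mx A ->
  (forall i, (0 <= x i)%R) -> mulM (of_mx A) (col_emx x) i tt = (app A x i)%:E.
Proof.
move=> A0 x0; rewrite /mulM esum_ordE; last first.
  by move=> j; rewrite mule_ge0// lee_fin.
by rewrite /app -sumEFin; apply: eq_bigr => j _; rewrite EFinM.
Qed.

Definition fine_mx m (T : emx R 'I_m 'I_m) : 'M[R]_m := \matrix_(i, j) fine (T i j).

Lemma fine_mxK m (T : emx R 'I_m 'I_m) : finiteM T -> of_mx (fine_mx T) = T.
Proof.
by move=> fT; apply/funext => i; apply/funext => j; rewrite /of_mx mxE fineK.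
Qed.

Lemma fine_mx_ge0 m (T : emx R 'I_m 'I_m) : ge0M T -> nonneg_mx (fine_mx T).
Proof. by move=> T0 i j; rewrite mxE fine_ge0. Qed.

Lemma fine_colK m (x : emx R 'I_m unit) : finiteM x ->
  col_emx (fun i => fine (x i tt)) = x.
Proof.
by move=> fx; apply/funext => i; apply/funext => -[]; rewrite /col_emx fineK.
Qed.

Lemma mulM_finite (n : nat) (I J : choiceType) (S : emx R I 'I_n) (T : emx R 'I_n J) :
  ge0M S -> ge0M T -> finiteM S -> finiteM T -> finiteM (mulM S T).
Proof.
move=> S0 T0 fS fT i j; rewrite /mulM esum_ordE => [|k]; last exact: mule_ge0.
by apply/sum_fin_numP => k _ _; rewrite fin_numM.
Qed.

End RealVectors.

(** * First passages and superharmonic sequences on the levels *)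

Section Levels.
Variables (R : realType) (m : nat) (Am1 A0 A1 : 'M[R]_m).
Hypotheses (Am1_ge0 : nonneg_mx Am1) (A0_ge0 : nonneg_mx A0) (A1_ge0 : nonneg_mx A1).
Local Open Scope ereal_scope.

Let am1_ge0 := of_mx_ge0 Am1_ge0.
Let a0_ge0 := of_mx_ge0 A0_ge0.
Let a1_ge0 := of_mx_ge0 A1_ge0.

Definition unlevel (L : Type) (z : nat -> emx R 'I_m L) : emx R (nat * 'I_m)%type L :=
  fun x => z x.1 x.2.

Lemma qbd_levels_ge0 (C : emx R 'I_m 'I_m) : ge0M C -> ge0M (qbd_levels Am1 A0 A1 C).
Proof.
move=> C0 [k i] [l j] /=; case: ifP => // _; case: ifP => [_|_]; first exact: a0_ge0.
case: ifP => [_|_]; first exact: a1_ge0.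
by case: ifP => // _; exact: am1_ge0.
Qed.

Lemma esum_level (f : nat * 'I_m -> \bar R) k : (forall x, 0 <= f x) ->
  (forall l j, l != k -> f (l, j) = 0) ->
  \esum_(x in [set: nat * 'I_m]) f x = \esum_(j in [set: 'I_m]) f (k, j).
Proof.
move=> f0 fk; rewrite esum_pairE// -[RHS](@esum_if1 _ nat _ k); last exact: esum_ge0.
apply: eq_esum => l _; case: eqVneq => [->//|lk].
by apply: esum1 => j _; exact: fk.
Qed.

Lemma qbd_mulE (L : choiceType) (C : emx R 'I_m 'I_m) (z : nat -> emx R 'I_m L) k i l :
  ge0M C -> (forall k, ge0M (z k)) ->
  mulM (qbd_levels Am1 A0 A1 C) (unlevel z) (k, i) l =
  match k with
  | 0%N => mulM C (z 0%N) i l + mulM (of_mx A1) (z 1%N) i l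
  | k'.+1 => mulM (of_mx Am1) (z k') i l + mulM (of_mx A0) (z k) i l +
             mulM (of_mx A1) (z k.+1) i l
  end.
Proof.
move=> C0 z0; set T := qbd_levels _ _ _ _.
have T0 : ge0M T by exact: qbd_levels_ge0.
(* [part p] is the contribution of the columns at index [p]; at most three indices contribute. *)
pose part p x := if x.1 == p then T (k, i) x * unlevel z x l else 0.
have part0 p x : 0 <= part p x.
  by rewrite /part; case: ifP => // _; rewrite mule_ge0//; exact: z0.
have partE p (B : emx R 'I_m 'I_m) : (forall j, T (k, i) (p, j) = B i j) ->
    \esum_(x in [set: nat * 'I_m]) part p x = mulM B (z p) i l.
  move=> TB; rewrite (@esum_level _ p)//; last first.
    by move=> q j /negPf qp; rewrite /part/= qp.
  by apply: eq_esum => j _; rewrite /part [(p, j).1]/= eqxx TB.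
rewrite [LHS]/mulM; case: k => [|k] in T0 part part0 partE *.
- rewrite -(partE 0%N C)// -(partE 1%N (of_mx A1))//.
  rewrite -esumD//; apply: eq_esum => -[[|[|q]] j] _;
    by rewrite /part/= ?addr0 ?add0r ?adde0 ?add0e// mul0e.
- rewrite -(partE k (of_mx Am1)); last first.
    by move=> j; rewrite /T/= eqSS eqxx !(ltn_eqF, eqn_leq) ?ltnn ?andbF.
  rewrite -(partE k.+1 (of_mx A0)); last by move=> j; rewrite /T/= eqxx.
  rewrite -(partE k.+2 (of_mx A1)); last first.
    by move=> j; rewrite /T/= !eqSS eqxx eqn_leq ltnn.
  rewrite -!esumD//; last by move=> x _; rewrite adde_ge0.
  apply: eq_esum => -[q j] _; rewrite /part/=.
  have [->|qk] := eqVneq q k.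
    by rewrite (ltn_eqF (leqnn k.+1)) (ltn_eqF (leqnSn k.+1)) !adde0.
  have [->|qk1] := eqVneq q k.+1; first by rewrite (ltn_eqF (leqnn k.+2)) adde0 add0e.
  have [->|qk2] := eqVneq q k.+2; first by rewrite !add0e.
  by rewrite eqSS (eq_sym k) (negPf qk) mul0e !adde0.
Qed.

Let Kp := qbd_Kplus Am1 A0 A1.
Let N := qbd_N Am1 A0 A1.

Lemma Kplus_ge0 : ge0M Kp. Proof. exact: qbd_levels_ge0. Qed.
Lemma N_ge0 : ge0M N. Proof. exact/neumann_ge0/Kplus_ge0. Qed.

(** In the paper's numbering of the levels this is the first passage from level
    [k + 1] to level [0], split at the last visit to level [1]; it equals
    [G_- ^ (k + 1)], but only inequalities between the two are needed. *)
Definition first_passage (k : nat) : emx R 'I_m 'I_m :=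
  mulM (fun i j => N (k, i) (0%N, j)) (of_mx Am1).

Lemma first_passage_ge0 k : ge0M (first_passage k).
Proof. by apply: mulM_ge0 => // i j; exact: N_ge0. Qed.

Lemma first_passage0 : first_passage 0 = G_minus Am1 A0 A1.
Proof. by []. Qed.

(** The flow out of [Kplus] into level [0], weighted by boundary values [v] there. Index [0] is
    level [1], the only level with a step down to level [0]. *)
Definition down_source (v : emx R 'I_m unit) : emx R (nat * 'I_m)%type unit :=
  fun x _ => if x.1 == 0%N then mulM (of_mx Am1) v x.2 tt else 0.

Lemma down_source_ge0 v : ge0M v -> ge0M (down_source v).
Proof. by move=> v0 x l; rewrite /down_source; case: ifP => // _; exact: mulM_ge0. Qed.

(** Puts first passages in the form [N s], to which the minimality and fixed-point properties of
    Neumann series apply. *)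
Lemma first_passageE v k i : ge0M v ->
  mulM (first_passage k) v i tt = mulM N (down_source v) (k, i) tt.
Proof.
move=> v0; rewrite /first_passage mulMA//; last by move=> p q; exact: N_ge0.
rewrite [RHS]/mulM (@esum_level _ 0%N)//.
- by move=> x; rewrite mule_ge0//; [exact: N_ge0|exact: down_source_ge0].
- by move=> p q /negPf p0; rewrite /down_source/= p0 mule0.
Qed.

(** Superharmonicity on the levels [k >= 1] only: level [0] acts as boundary value. *)
Definition super_levels (z : nat -> emx R 'I_m unit) : Prop := forall k i,
  mulM (of_mx Am1) (z k) i tt + mulM (of_mx A0) (z k.+1) i tt +
  mulM (of_mx A1) (z k.+2) i tt <= z k.+1 i tt.

(** The shift by one: block [z k.+1] sits at index [k] of [Kplus], so [z 0] lies outside and enters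
    through the source. *)
Lemma super_levelsE (z : nat -> emx R 'I_m unit) k i : (forall k, ge0M (z k)) ->
  mulM Kp (unlevel (fun k => z k.+1)) (k, i) tt + down_source (z 0%N) (k, i) tt =
  mulM (of_mx Am1) (z k) i tt + mulM (of_mx A0) (z k.+1) i tt +
  mulM (of_mx A1) (z k.+2) i tt.
Proof.
move=> z0; rewrite qbd_mulE//; case: k => [|k]; rewrite /down_source/= ?adde0//.
by rewrite addeC addeA.
Qed.

(** For [k = 0] this is the minimality of [G_minus]; it is inherited from that of [N s] among the
    solutions of [Kp y + s <= y]. *)
Lemma first_passage_min (z : nat -> emx R 'I_m unit) : (forall k, ge0M (z k)) ->
  super_levels z -> forall k i, mulM (first_passage k) (z 0%N) i tt <= z k.+1 i tt.
Proof.
move=> z0 sz k i; rewrite first_passageE//.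
pose y := unlevel (fun k => z k.+1).
apply: (@neumann_min _ _ _ Kp _ y tt _ _ _ _ (k, i)).
- exact: Kplus_ge0.
- exact: down_source_ge0.
- by move=> x l; exact: z0.
- by move=> [p q]; rewrite super_levelsE.
Qed.

(** The harmonic extension of the boundary values [v], standing for the sequence [G_minus ^ k v]. *)
Definition first_passage_levels (v : emx R 'I_m unit) (k : nat) : emx R 'I_m unit :=
  if k is k'.+1 then mulM (first_passage k') v else v.

Lemma first_passage_levels_ge0 v k : ge0M v -> ge0M (first_passage_levels v k).
Proof. by move=> v0; case: k => //= k; apply: mulM_ge0 => //; exact: first_passage_ge0. Qed.

(** The fixed-point equation of [N s], read block by block. *)
Lemma first_passage_levelsE v k i : ge0M v ->
  mulM (of_mx Am1) (first_passage_levels v k) i tt +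
  mulM (of_mx A0) (first_passage_levels v k.+1) i tt +
  mulM (of_mx A1) (first_passage_levels v k.+2) i tt = first_passage_levels v k.+1 i tt.
Proof.
move=> v0; set z := first_passage_levels v.
have z0 k' : ge0M (z k') by exact: first_passage_levels_ge0.
rewrite -super_levelsE// /z/= first_passageE//.
have -> : unlevel (fun k => mulM (first_passage k) v) = mulM N (down_source v).
  by apply/funext => -[p q]; apply/funext => -[]; rewrite -first_passageE.
have W := neumann_mul_fix Kplus_ge0 (down_source_ge0 v0).
by rewrite [RHS](congr1 (fun f => f (k, i) tt) W) /addM addeC.
Qed.

Hypothesis reach_down : forall k i, exists2 i', 0 < N (k, i) (0%N, i') &
  exists j, 0 < of_mx Am1 i' j.

Lemma first_passage_gt0 k i : exists j, 0 < first_passage k i j.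
Proof.
have [i' Nii' [j Aj]] := reach_down k i; exists j.
by apply: (@mulM_gt0 _ _ _ _ _ _ i i' j) => // p q; exact: N_ge0.
Qed.

Lemma first_passage_col_gt0 k v i : ge0M v -> (forall i, 0 < v i tt) ->
  0 < mulM (first_passage k) v i tt.
Proof.
move=> v0 v_gt0; have [j Wj] := first_passage_gt0 k i.
exact: mulM_gt0 (first_passage_ge0 k) v0 Wj (v_gt0 j).
Qed.

(** The blocks from [z 1] on form a supersolution for the source given by [z 0], and by [reach_down]
    every state reaches the support of that source. *)
Lemma N_finite (z : nat -> emx R 'I_m unit) : (forall k, ge0M (z k)) ->
  (forall k, finiteM (z k)) -> (forall i, 0 < z 0%N i tt) ->
  super_levels z -> finiteM N.
Proof.
move=> z0 fz z_gt0 sz.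
apply: (@neumann_finite _ _ Kp (down_source (z 0%N)) (unlevel (fun k => z k.+1))).
- exact: Kplus_ge0.
- exact: down_source_ge0.
- by move=> x l; exact: z0.
- by move=> x l; exact: fz.
- by move=> [p q]; rewrite super_levelsE.
- move=> [k i]; have [i' Nii' [j Aj]] := reach_down k i.
  exists (0%N, i') => //; rewrite /down_source/=.
  exact: mulM_gt0 Aj (z_gt0 j).
Qed.

Lemma first_passage_finite k : finiteM N -> finiteM (first_passage k).
Proof.
by move=> fN; apply: mulM_finite => // i j; exact: N_ge0.
Qed.

End Levels.

(** * Consequences of the irreducibility of [K] *)

Section Irreducibility.
Variables (R : realType) (m0 m : nat) (Am1 A0 A1 : 'M[R]_m).
Variables (B0 : 'M[R]_m0) (B1 : 'M[R]_(m0, m)) (Bm1 : 'M[R]_(m, m0)).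
Hypotheses (Am1_ge0 : nonneg_mx Am1) (A0_ge0 : nonneg_mx A0) (A1_ge0 : nonneg_mx A1).
Hypotheses (B0_ge0 : nonneg_mx B0) (B1_ge0 : nonneg_mx B1) (Bm1_ge0 : nonneg_mx Bm1).
Local Open Scope ereal_scope.

Let K := qbd_K Am1 A0 A1 B0 B1 Bm1.
Let C0 := qbd_C0 A0 B0 B1 Bm1.
Let Kbar := qbd_Kbar Am1 A0 A1 B0 B1 Bm1.
Let Kp := qbd_Kplus Am1 A0 A1.
(** Exit from level [0]: a sojourn of any length there, then the step into level [1]. *)
Let E := mulM (neumann (of_mx B0)) (of_mx B1).

Lemma qbd_K_ge0 : ge0M K.
Proof.
move=> [i|[k i]] [j|[l j]] /=; rewrite ?lee_fin//.
- by case: ifP => // _; rewrite lee_fin.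
- by case: ifP => // _; rewrite lee_fin.
- by have := qbd_levels_ge0 Am1_ge0 A0_ge0 A1_ge0 (of_mx_ge0 A0_ge0) (k, i) (l, j).
Qed.

Lemma exit_ge0 : ge0M E.
Proof. exact: mulM_ge0 (neumann_ge0 (of_mx_ge0 B0_ge0)) (of_mx_ge0 B1_ge0). Qed.

Lemma qbd_C0E : C0 = addM (mulM (of_mx Bm1) E) (of_mx A0).
Proof.
rewrite /C0 /qbd_C0 mulMA//; try exact: of_mx_ge0.
exact/neumann_ge0/of_mx_ge0.
Qed.

Lemma qbd_C0_ge0 : ge0M C0.
Proof.
rewrite qbd_C0E; apply: addM_ge0; last exact: of_mx_ge0.
by apply: mulM_ge0; [exact: of_mx_ge0|exact: exit_ge0].
Qed.

Lemma qbd_Kbar_ge0 : ge0M Kbar.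
Proof. exact: qbd_levels_ge0 qbd_C0_ge0. Qed.

(** Excise the sojourns in level [0] from a path of [K]. *)
Lemma qbd_Kbar_reach_pow n z :
  (forall y, 0 < powM K n (inr y) (inr z) -> exists p, 0 < powM Kbar p y z) /\
  (forall i, 0 < powM K n (inl i) (inr z) ->
     exists2 j, 0 < E i j & exists p, 0 < powM Kbar p (0%N, j) z).
Proof.
have B0' := of_mx_ge0 B0_ge0; have B1' := of_mx_ge0 B1_ge0.
have NB0 := neumann_ge0 B0'.
have step y w p : 0 < Kbar y w -> 0 < powM Kbar p w z ->
    exists p, 0 < powM Kbar p y z.
  move=> yw wz; exists p.+1; rewrite powMS.
  exact: (mulM_gt0 qbd_Kbar_ge0 (powM_ge0 p qbd_Kbar_ge0) yw wz).
elim: n => [|n [IHr IHl]]; split.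
- move=> y; rewrite /powM/= /idM; case: eqP => [[->]|]; last by rewrite ltxx.
  by move=> _; exists 0%N; rewrite /powM/= /idM eqxx.
- by move=> i; rewrite /powM/= /idM; case: eqP => //; rewrite ltxx.
- move=> [k i] /(mulM_gt0P qbd_K_ge0 (powM_ge0 n qbd_K_ge0))[[i'|[l j]] Kw wz].
  (* A step down to level [0] followed by an exit gives a positive entry of [Bm1 E], hence a single
     step of [Kbar] inside its corner block. *)
  + move: Kw => /=; case: eqP => [->|]; last by rewrite ltxx.
    move=> Bm1i; have [j Ej [p pj]] := IHl _ wz; apply: step pj.
    rewrite /Kbar/= /qbd_Kbar/= -/C0 qbd_C0E /addM.
    apply: lt_le_trans (leeDl _ _); last exact: of_mx_ge0.
    by apply: (mulM_gt0 _ exit_ge0 _ Ej) => //; exact: of_mx_ge0.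
  + have [p pw] := IHr _ wz; apply: step pw; move: Kw.
    rewrite /K /qbd_K /Kbar /qbd_Kbar /qbd_levels.
    case: ifP => // _ /lt_le_trans; apply.
    rewrite -/C0 qbd_C0E /addM leeDr//.
    by apply: mulM_ge0; [exact: of_mx_ge0|exact: exit_ge0].
- move=> i /(mulM_gt0P qbd_K_ge0 (powM_ge0 n qbd_K_ge0))[[i'|[l j]] Kw wz].
  + have [j Ej pj] := IHl _ wz; exists j => //.
    rewrite /E neumann_mul_fix// /addM; apply: lt_le_trans (leeDr _ _) => //.
    exact: (mulM_gt0 B0' exit_ge0 Kw Ej).
  + move: Kw => /=; case: eqP => [l0|]; last by rewrite ltxx.
    rewrite l0 in wz * => B1ij; exists j; last exact: IHr wz.
    rewrite /E neumann_mul_fix// /addM; apply: lt_le_trans (leeDl _ _) => //.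
    by apply: mulM_ge0 => //; exact: exit_ge0.
Qed.

Hypothesis m0_gt0 : (0 < m0)%N.
Hypothesis K_irr : irreducibleM K.

Lemma qbd_Kbar_connected y z : exists p, 0 < powM Kbar p y z.
Proof.
have [n _ Kn] := K_irr (inr y) (inr z).
by have [+ _] := qbd_Kbar_reach_pow n z; apply.
Qed.

(** A path of [K] from index [k + 1] to level [0] passes through index [0]. Before that it avoids
    the boundary blocks, so lowered by one index it is a path of [Kplus]. The step that first
    reaches index [0] is made by [Am1]. *)
Lemma qbd_reach_down k i : exists2 i', 0 < qbd_N Am1 A0 A1 (k, i) (0%N, i') &
  exists j, 0 < of_mx Am1 i' j.
Proof.
have Kp0 : ge0M Kp by exact: Kplus_ge0.
have [n _] := K_irr (inr (k.+1, i)) (inl (Ordinal m0_gt0)).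
elim: n k i => [|n IHn] k i; first by rewrite /powM/= /idM; case: eqP => //; rewrite ltxx.
move=> /(mulM_gt0P qbd_K_ge0 (powM_ge0 n qbd_K_ge0))[[i'|[[|l] j]] Kw wz].
- by move: Kw; rewrite /= ltxx.
- have [k0 Aij] : k = 0%N /\ 0 < of_mx Am1 i j.
    by move: Kw => /=; rewrite eqSS; case: eqP => // _; rewrite ltxx.
  exists i; last by exists j.
  apply: lt_le_trans (le_powM_neumann 0 _ _ Kp0).
  by rewrite k0 /powM/= /idM eqxx.
- have [i' Ni' Ai'] := IHn _ _ wz; exists i' => //.
  rewrite /qbd_N -/Kp neumannE// /addM.
  apply: lt_le_trans (leeDr _ _); last exact: idM_ge0.
  apply: (mulM_gt0 Kp0 (neumann_ge0 Kp0) _ Ni').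
  suff -> : Kp (k, i) (l, j) = K (inr (k.+1, i)) (inr (l.+1, j)) by [].
  rewrite /Kp /K /qbd_Kplus /=.
  rewrite !eqSS; case: ifP => // /andP[/eqP-> /eqP->].
  by rewrite eqxx.
Qed.

End Irreducibility.

(** * Positivity of supersolutions of [A_star theta] *)

Section AStar.
Variables (R : realType) (m : nat) (Am1 A0 A1 : 'M[R]_m).
Hypotheses (Am1_ge0 : nonneg_mx Am1) (A0_ge0 : nonneg_mx A0) (A1_ge0 : nonneg_mx A1).

Lemma A_star_ge0 theta : nonneg_mx (A_star Am1 A0 A1 theta).
Proof.
by move=> i j; rewrite !mxE !addr_ge0// mulr_ge0// expR_ge0.
Qed.

Lemma app_A_star theta x i : app (A_star Am1 A0 A1 theta) x i =
  expR (- theta) * app Am1 x i + app A0 x i + expR theta * app A1 x i.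
Proof.
rewrite /app !mulr_sumr -!big_split/=; apply: eq_bigr => j _.
by rewrite !mxE !mulrDl !mulrA.
Qed.

Hypothesis A_irr : irreducibleM (of_mx (A_star Am1 A0 A1 0)).

(** Irreducibility is given at [0] only. Entrywise [A_star 0 <= c A_star theta] with
    [c = e^theta + e^(-theta) + 1], so [x] is a supersolution for [A_star 0] too, and positivity
    spreads along the paths of that matrix. *)
Lemma A_star_super_gt0 theta t (x : 'I_m -> R) : (forall i, 0 <= x i) ->
  (exists i, 0 < x i) -> (forall i, app (A_star Am1 A0 A1 theta) x i <= t * x i) ->
  forall i, 0 < x i.
Proof.
move=> x0 [j xj] xt i.
pose c := expR theta + expR (- theta) + 1.
have e1 : 0 < expR theta by exact: expR_gt0.
have e2 : 0 < expR (- theta) by exact: expR_gt0.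
have e12 : expR theta * expR (- theta) = 1 by rewrite -expRD subrr expR0.
have c0 : 0 < c by rewrite /c; lra.
have t0 : 0 <= t.
  have : 0 <= t * x j by apply: le_trans (xt j); exact/app_ge0/x0/A_star_ge0.
  by rewrite pmulr_lge0.
have A0x k : app (A_star Am1 A0 A1 0) x k <= c * t * x k.
  rewrite -mulrA; apply: le_trans (ler_wpM2l (ltW c0) (xt k)).
  rewrite !app_A_star oppr0 expR0 !mul1r !mulrDr !mulrA.
  apply: lerD; first apply: lerD.
  - by rewrite ler_peMl ?app_ge0// /c; nra.
  - by rewrite ler_peMl ?app_ge0// /c; lra.
  - by rewrite ler_peMl ?app_ge0// /c; nra.
have As0 := of_mx_ge0 (A_star_ge0 0).
have cx0 := col_emx_ge0 x0.
have [n _ An] := A_irr i j.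
have ct0 : 0 <= c * t by rewrite mulr_ge0// ltW.
have := @powM_super _ _ _ _ (col_emx x) _ n tt As0 cx0 ct0 _ i.
move=> /(_ _)/(le_trans (le_term_mulM i j tt (powM_ge0 n As0) cx0)) => le_pow.
have {le_pow} : (0 < ((c * t) ^+ n)%:E * (x i)%:E)%E.
  apply: lt_le_trans (le_pow _); first by rewrite mule_gt0// lte_fin.
  by move=> k; rewrite mulM_col ?lee_fin//; exact: A_star_ge0.
rewrite -EFinM lte_fin; apply: contraTT; rewrite -!leNgt => xi.
by rewrite mulr_ge0_le0// exprn_ge0.
Qed.

End AStar.

(** * Nonemptiness of [Gamma] and finiteness of [N] *)

Section Drift.
Variables (R : realType) (m : nat) (Am1 A0 A1 : 'M[R]_m).
Hypothesis m_gt0 : (0 < m)%N.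
Hypotheses (Am1_ge0 : nonneg_mx Am1) (A0_ge0 : nonneg_mx A0) (A1_ge0 : nonneg_mx A1).
Hypothesis A_irr : irreducibleM (of_mx (A_star Am1 A0 A1 0)).

Let Gamma := Gamma_plus_1d Am1 A0 A1.
Let N := qbd_N Am1 A0 A1.
Let G := G_minus Am1 A0 A1.

Hypothesis reach_down : forall k i, exists2 i', (0 < N (k, i) (0%N, i'))%E &
  exists j, (0 < of_mx Am1 i' j)%E.

Lemma N_finite_of_Gamma : Gamma !=set0 -> finiteM N.
Proof.
move=> [theta]; rewrite /Gamma /Gamma_plus_1d/= => pf1.
have As0 := A_star_ge0 Am1_ge0 A0_ge0 A1_ge0 theta.
have [[h hS Ah] _] := gamma_pfP m_gt0 As0.
have [h0 _] := hS.
have Ah1 i : app (A_star Am1 A0 A1 theta) (h 0) i <= 1 * h 0 i.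
  by rewrite Ah ler_wpM2r.
have h_gt0 := A_star_super_gt0 Am1_ge0 A0_ge0 A1_ge0 A_irr h0 (simplex_nz hS) Ah1.
pose z k : emx R 'I_m unit := col_emx (fun i => expR theta ^+ k * h 0 i).
have zk0 k i : 0 <= expR theta ^+ k * h 0 i by rewrite mulr_ge0// exprn_ge0// expR_ge0.
apply: (@N_finite _ _ _ _ _ Am1_ge0 A0_ge0 A1_ge0 reach_down z) => //.
- by move=> k; exact: col_emx_ge0.
- by move=> i; rewrite lte_fin expr0 mul1r.
move=> k i; rewrite /z !mulM_col// !appZ -!EFinD lee_fin.
(* The required inequality for block [k.+1] is [A_star theta h <= h] multiplied by
   [e^(theta (k + 1))]. *)
have := ler_wpM2l (exprn_ge0 k.+1 (expR_ge0 theta)) (Ah1 i).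
rewrite mul1r app_A_star !mulrDr; apply: le_trans.
rewrite le_eqVlt; apply/orP; left; apply/eqP.
congr (_ + _ + _); rewrite ?exprSr !mulrA//.
by rewrite -[expR theta ^+ k * _ * _]mulrA -expRD subrr expR0 mulr1.
Qed.

Lemma G_finite : finiteM N -> finiteM G.
Proof. by move=> fN; rewrite /G -first_passage0; exact: first_passage_finite. Qed.

(** An eigenvector [h] of [G_-] with eigenvalue [g] satisfies
    [A_{-1} h + g A_0 h + g^2 A_1 h <= g h], i.e. [A_*(ln g) h <= h]. *)
Lemma Gamma_of_N_finite : finiteM N -> Gamma !=set0.
Proof.
move=> fN; have fG := G_finite fN.
have G0 : ge0M G by rewrite /G -first_passage0; exact: first_passage_ge0.
have Gx (x : 'I_m -> R) i : (forall i, 0 <= x i) ->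
    mulM G (col_emx x) i tt = (app (fine_mx G) x i)%:E.
  by move=> x0; rewrite -mulM_col ?fine_mxK//; exact: fine_mx_ge0.
have [g g0 [[h hS Gh] super]] := perron_frobenius m_gt0 (fine_mx_ge0 G0).
have [h0 _] := hS.
(* The logarithm needs [g > 0]. Every row of [G] has a positive entry, so [G 1 >= c 1] with [c > 0],
   and comparison with supersolutions for [g + e] yields [c <= g]. *)
have row_gt0 i : 0 < \sum_j fine_mx G i j.
  have [j Gij] := first_passage_gt0 Am1_ge0 A0_ge0 A1_ge0 reach_down 0%N i.
  rewrite (bigD1 j)//= ltr_pwDl//.
    by rewrite mxE fine_gt0// Gij -ge0_fin_numE ?ltW//; exact: fG.
  by apply: sumr_ge0 => k _; exact: fine_mx_ge0.
have [c c0 cG] := finite_pos_lb row_gt0.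
have cg : c <= g.
  apply/ler_addgt0Pr => e e0.
  have [x x0 xt] := super (g + e) (ltr_pwDr e0 (lexx g)).
  apply: (@sub_super_le _ _ (fine_mx G) (fun=> 1) x) => //; first exact: fine_mx_ge0.
  - by exists (Ordinal m_gt0).
  - move=> i; rewrite mulr1; apply: le_trans (cG i) _.
    by rewrite /app; under [leRHS]eq_bigr do rewrite mulr1.
have g_gt0 : 0 < g by apply: lt_le_trans cg.
have v0 := col_emx_ge0 h0.
pose z := first_passage_levels Am1 A0 A1 (col_emx (h 0)).
have z0 k : ge0M (z k) by exact: first_passage_levels_ge0.
pose h1 j := g * h 0 j; pose h2 j := g * h1 j.
have h1_ge0 j : 0 <= h1 j by rewrite mulr_ge0.
have h2_ge0 j : 0 <= h2 j by rewrite mulr_ge0.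
have z1 : z 1%N = col_emx h1.
  apply/funext => i; apply/funext => -[]; rewrite /z/= first_passage0 Gx//.
  by rewrite Gh.
(* Without its lowest block the sequence is still superharmonic, with boundary value [z 1 = g h];
   minimality then gives [z 2 >= G (g h) = g^2 h]. *)
have sz : super_levels Am1 A0 A1 (fun k => z k.+1).
  by move=> k i; rewrite first_passage_levelsE.
have z2 i : ((h2 i)%:E <= z 2%N i tt)%E.
  have := first_passage_min Am1_ge0 A0_ge0 A1_ge0 (fun k => z0 k.+1) sz 0%N i.
  by rewrite first_passage0 z1 Gx// appZ Gh.
(* In the equation for [z 1], replace [z 2] by the smaller [g^2 h] and divide by [g]. *)
have Ah i : app (A_star Am1 A0 A1 (ln g)) (h 0) i <= 1 * h 0 i.
  have : (mulM (of_mx Am1) (z 0%N) i tt + mulM (of_mx A0) (col_emx h1) i tt +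
      mulM (of_mx A1) (col_emx h2) i tt <= (h1 i)%:E)%E.
    have := first_passage_levelsE Am1_ge0 A0_ge0 A1_ge0 0%N i v0.
    rewrite -/z z1 -[RHS]/(h1 i)%:E => <-.
    apply: leeD => //; apply: le_mulM => [| |//|j].
    - exact: of_mx_ge0.
    - exact: col_emx_ge0.
    - exact: z2.
  rewrite /z/= !mulM_col// !appZ -!EFinD lee_fin app_A_star expRN lnK ?posrE// mul1r => le_gh.
  by rewrite -(ler_pM2l g_gt0) !mulrDr mulrA divff ?gt_eqF// mul1r.
have h_gt0 := A_star_super_gt0 Am1_ge0 A0_ge0 A1_ge0 A_irr h0 (simplex_nz hS) Ah.
exists (ln g); rewrite /Gamma /Gamma_plus_1d/=.
by apply: (@pf_le_super _ _ _ (h 0)) => //; exact: A_star_ge0.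
Qed.

End Drift.

(** * Reduction to the corner matrix [D] *)

Section Corner.
Variables (R : realType) (m : nat) (Am1 A0 A1 : 'M[R]_m) (C : emx R 'I_m 'I_m).
Hypothesis m_gt0 : (0 < m)%N.
Hypotheses (Am1_ge0 : nonneg_mx Am1) (A0_ge0 : nonneg_mx A0) (A1_ge0 : nonneg_mx A1).
Hypothesis C_ge0 : ge0M C.
Local Open Scope ereal_scope.

Let N := qbd_N Am1 A0 A1.
Let G := G_minus Am1 A0 A1.
Let D := addM C (mulM (of_mx A1) G).
Let T := qbd_levels Am1 A0 A1 C.

Hypothesis reach_down : forall k i, exists2 i', 0 < N (k, i) (0%N, i') &
  exists j, 0 < of_mx Am1 i' j.

Let G0 : ge0M G. Proof. by rewrite /G -first_passage0; exact: first_passage_ge0. Qed.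

Lemma corner_ge0 : ge0M D.
Proof. by apply: addM_ge0 => //; apply: mulM_ge0 => //; exact: of_mx_ge0. Qed.

Lemma mul_corner (v : emx R 'I_m unit) i : ge0M v ->
  mulM D v i tt = mulM C v i tt + mulM (of_mx A1) (mulM G v) i tt.
Proof.
move=> v0; have a10 := of_mx_ge0 A1_ge0.
by rewrite /D mulMDl//; [rewrite mulMA|exact: mulM_ge0].
Qed.

Lemma corner_of_super (t : R) (y : emx R (nat * 'I_m)%type unit) :
  (0 <= t <= 1)%R -> ge0M y -> finiteM y -> (forall x, 0 < y x tt) ->
  (forall x, mulM T y x tt <= t%:E * y x tt) ->
  finiteM N /\ egamma_pf D <= t%:E.
Proof.
move=> /andP[t0 t1] y0 fy y_gt0 ty.
pose z k : emx R 'I_m unit := fun i l => y (k, i) l.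
have z0 k : ge0M (z k) by move=> i l; exact: y0.
have yE : y = unlevel z by apply/funext => -[].
(* Here [t <= 1] is used: above the lowest block [y] is superharmonic with factor [1]. *)
have sz : super_levels Am1 A0 A1 z.
  move=> k i; have := ty (k.+1, i); rewrite yE qbd_mulE// => /le_trans; apply.
  by rewrite gee_pMl ?lee_fin//; exact: y0.
have Dz i : mulM D (z 0%N) i tt <= t%:E * z 0%N i tt.
  have := ty (0%N, i); rewrite yE qbd_mulE// mul_corner//; apply: le_trans.
  rewrite leeD2l//; apply: le_mulM => [| |//|j]; first exact: of_mx_ge0.
    exact: mulM_ge0.
  by rewrite /G -first_passage0; exact: first_passage_min.
(* [D i j * z j <= t * z i] is finite and [z j > 0]; this excludes the value [+oo] of
   [egamma_pf D]. *)
have fD : finiteM D.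
  move=> i j; have D0 := corner_ge0.
  rewrite ge0_fin_numE// ltey.
  apply: contraTneq (le_trans (le_term_mulM i j tt D0 (z0 0%N)) (Dz i)) => ->.
  by rewrite gt0_mulye ?y_gt0// -ltNge ltey_eq fin_numM//; exact: fy.
split.
  apply: (@N_finite _ _ _ _ _ Am1_ge0 A0_ge0 A1_ge0 reach_down z) => //.
  - by move=> k i l; exact: fy.
  - by move=> i; exact: y_gt0.
rewrite /egamma_pf; case: asboolP => // _; rewrite lee_fin.
pose x i := fine (z 0%N i tt).
have x_gt0 i : (0 < x i)%R.
  by rewrite fine_gt0// y_gt0 ltey_eq fy.
have zx : col_emx x = z 0%N by apply: fine_colK => i l; exact: fy.
apply: (@pf_le_super _ _ (fine_mx D) x) => //; first exact/fine_mx_ge0/corner_ge0.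
move=> i; rewrite -lee_fin -mulM_col; last 2 first.
- exact/fine_mx_ge0/corner_ge0.
- by move=> j; rewrite ltW.
by rewrite fine_mxK// EFinM -[(x i)%:E]/(col_emx x i tt) zx.
Qed.

(** [gamma_pfP] yields positive supersolutions of [D] for factors above [gamma_pf], whence [1 < t].
    Once extended by first passages, such a vector needs the factor in the lowest block only, since
    the other blocks are harmonic. *)
Lemma super_of_corner (t : R) : finiteM N -> finiteM D -> egamma_pf D <= 1 ->
  (1 < t)%R -> exists y : emx R (nat * 'I_m)%type unit,
     [/\ ge0M y, finiteM y, forall i, 0 < y i tt &
         forall i, mulM T y i tt <= t%:E * y i tt].
Proof.
move=> fN fD; rewrite /egamma_pf asboolT// lee_fin => pf1 t1.
have D0 := corner_ge0.
have [_ super] := gamma_pfP m_gt0 (fine_mx_ge0 D0).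
have [x x_gt0 xt] := super t (le_lt_trans pf1 t1).
have x0 i : (0 <= x i)%R by rewrite ltW.
have v0 := col_emx_ge0 x0.
pose z := first_passage_levels Am1 A0 A1 (col_emx x).
have z0 k : ge0M (z k) by exact: first_passage_levels_ge0.
exists (unlevel z); split.
- by move=> p l; exact: z0.
- move=> [[|k] i] l //; rewrite /unlevel/=.
  by apply: mulM_finite => //; [exact: first_passage_ge0|exact: first_passage_finite].
- move=> [[|k] i]; first by rewrite /unlevel/= lte_fin.
  by apply: first_passage_col_gt0 => // j; rewrite lte_fin.
- move=> [[|k] i]; rewrite qbd_mulE//.
  + rewrite /z/= first_passage0 -mul_corner// -(fine_mxK fD) mulM_col//.
      by rewrite -EFinM lee_fin.
    exact: fine_mx_ge0.
  + rewrite first_passage_levelsE// /unlevel/= lee_pemull ?lee_fin ?(ltW t1)//.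
    exact: (z0 k.+1).
Qed.

End Corner.

(** * From the corner matrix to the convergence parameter of [Kbar] *)

Theorem theorem2p1 (R : realType) (m0 m : nat)
  (m0_gt0 : (0 < m0)%N) (m_gt0 : (0 < m)%N)
  (Am1 A0 A1 : 'M[R]_m)
  (B0 : 'M[R]_m0) (B1 : 'M[R]_(m0, m)) (Bm1 : 'M[R]_(m, m0))
  (Am1_ge0 : nonneg_mx Am1) (A0_ge0 : nonneg_mx A0) (A1_ge0 : nonneg_mx A1)
  (B0_ge0 : nonneg_mx B0) (B1_ge0 : nonneg_mx B1) (Bm1_ge0 : nonneg_mx Bm1)
  (K_irr : irreducibleM (qbd_K Am1 A0 A1 B0 B1 Bm1))
  (A_irr : irreducibleM (of_mx (A_star Am1 A0 A1 0))) :
  let Gamma := Gamma_plus_1d Am1 A0 A1 in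
  let N := qbd_N Am1 A0 A1 in
  let G := G_minus Am1 A0 A1 in
  let C0 := qbd_C0 A0 B0 B1 Bm1 in
  let Kbar := qbd_Kbar Am1 A0 A1 B0 B1 Bm1 in
  let D := addM C0 (mulM (of_mx A1) G) in
  (Gamma !=set0 -> finiteM N /\ finiteM G) /\
  ((1 <= conv_param Kbar)%E <-> Gamma !=set0 /\ (egamma_pf D <= 1)%E) /\
  (Gamma !=set0 -> egamma_pf D = 1%E -> conv_param Kbar = 1%E).
Proof.
move=> Gamma N G C0 Kbar D.
have Kbar_ge0 : ge0M Kbar by exact: qbd_Kbar_ge0.
have C0_ge0 : ge0M C0 by exact: qbd_C0_ge0.
have connected y z : exists p, (0 < powM Kbar p y z)%E by exact: qbd_Kbar_connected.
have down k i : exists2 i', (0 < N (k, i) (0%N, i'))%E & exists j, (0 < of_mx Am1 i' j)%E.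
  exact: (qbd_reach_down Am1_ge0 A0_ge0 A1_ge0 B0_ge0 B1_ge0 Bm1_ge0 m0_gt0 K_irr).
have finN : Gamma !=set0 -> finiteM N by exact: N_finite_of_Gamma.
pose o : nat * 'I_m := (0%N, Ordinal m_gt0).
have ge1 : (1 <= conv_param Kbar)%E <-> Gamma !=set0 /\ (egamma_pf D <= 1)%E.
  split=> [conv1|[Gamma0 pf1]].
    have [y [y0 fy y_gt0 Ky]] := subinvariant_vector Kbar_ge0 connected conv1 o.
    have [||fN pf1] := corner_of_super Am1_ge0 A0_ge0 A1_ge0 C0_ge0 down _ y0 fy y_gt0 (t := 1).
    - by rewrite ler01 lexx.
    - by move=> x; rewrite mul1e.
    by split=> //; exact: (Gamma_of_N_finite m_gt0 Am1_ge0 A0_ge0 A1_ge0 A_irr down).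
  apply: (conv_param_ge1 Kbar_ge0) => t t1.
  have fD : finiteM D.
    by move: pf1; rewrite /egamma_pf; case: asboolP.
  exact: (super_of_corner m_gt0 Am1_ge0 A0_ge0 A1_ge0 C0_ge0 down (finN Gamma0) fD pf1 t1).
split; first by move=> /finN fN; split=> //; exact: G_finite.
split=> // Gamma0 pf1; apply: le_anti; apply/andP; split; last first.
  by apply/ge1; rewrite pf1.
rewrite (conv_paramE Kbar_ge0); apply: ge_ereal_sup => _ [u [u0 fin] <-].
(* Convergence at some [u > 1] would give [Kbar y <= u^-1 y], hence [egamma_pf D <= u^-1 < 1],
   against the assumed equality. *)
rewrite leNgt lte_fin; apply/negP => u1.
have u_gt0 : 0 < u by apply: lt_trans u1.
have [y [y0 fy yo1 uy]] := resolvent_super Kbar_ge0 o u0 fin.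
have Ky x : (mulM Kbar y x tt <= (u^-1)%:E * y x tt)%E.
  by rewrite lee_pdivlMl.
(* [y] is at least [1] at [o], and paths to [o] carry positivity to every state. *)
have y_gt0 x : (0 < y x tt)%E.
  have [p Kp] := connected x o.
  have ui0 : 0 <= u^-1 by rewrite invr_ge0 ltW.
  have := powM_super p Kbar_ge0 y0 ui0 Ky x.
  move=> /(le_trans (le_term_mulM x o tt (powM_ge0 p Kbar_ge0) y0)) le_y.
  have : (0 < (u^-1 ^+ p)%:E * y x tt)%E.
    by apply: lt_le_trans le_y; rewrite mule_gt0// (lt_le_trans _ yo1).
  have [->|yx _] := eqVneq (y x tt) 0%E; first by rewrite mule0 ltxx.
  by rewrite lt_def yx y0.
have [|_] := corner_of_super Am1_ge0 A0_ge0 A1_ge0 C0_ge0 down _ y0 fy y_gt0 Ky.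
  by rewrite invr_ge0 ltW//= invf_le1// ltW.
by rewrite -/D pf1 lee_fin leNgt invf_lt1// u1.
Qed.
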